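(* Let $p$ be a prime, let $G$ be a finite $p$-solvable group, and let $\chi\in\operatorname{Irr}(G)$ with $a:=\nu_p(c(\chi))\ge1$. Then $[\mathbb{Q}_{p^a}(\chi):\mathbb{Q}_p(\chi)]$ divides $\chi(1)$.
   Context: $\nu_p$ is the $p$-adic valuation. $\mathbb{Q}_n:=\mathbb{Q}(e^{2\pi i/n})$. $\mathbb{Q}(\chi)$ is the field of values of $\chi$, $c(\chi)$ is the smallest $n\ge1$ with $\mathbb{Q}(\chi)\subseteq\mathbb{Q}_n$, and $\mathbb{Q}_m(\chi)$ is the compositum of $\mathbb{Q}_m$ and $\mathbb{Q}(\chi)$. *)

(* Defs.v *)
From HB Require Import structures.
From mathcomp Require Import all_boot all_order all_algebra all_fingroup all_solvable all_field all_character.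
Set Implicit Arguments. Unset Strict Implicit. Unset Printing Implicit Defensive.
Import GroupScope GRing.Theory Num.Theory.
Local Open Scope ring_scope.

Definition psolvable (gT : finGroupType) (p : nat) (G : {group gT}) : Prop :=
  exists s : seq {group gT},
    path (fun H K : {group gT} =>
            (H <| K) && (p.-group (K / H) || p^'.-group (K / H))) 1%G s
    /\ last 1%G s = G.

Definition zeta (n : nat) : algC :=
  match n with
  | 0 => 1
  | n'.+1 => sval (C_prim_root_exists (ltn0Sn n'))
  end.

Definition inQn (n : nat) (x : algC) : Prop :=
  exists q : {poly rat}, x = (map_poly ratr q).[zeta n].

Definition valsInQn (gT : finGroupType) (G : {group gT}) (chi : 'CF(G)) (n : nat)
  : Prop := forall g, g \in G -> inQn n (chi g).

Definition is_conductor (gT : finGroupType) (G : {group gT}) (chi : 'CF(G))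
  (c : nat) : Prop :=
  (0 < c)%N /\ valsInQn chi c /\ forall n, (0 < n)%N -> valsInQn chi n -> (c <= n)%N.

Definition cfvals (gT : finGroupType) (G : {group gT}) (chi : 'CF(G)) : seq algC :=
  [seq chi g | g in G].

(* relative degree [Q(s, t) : Q(s)] of the subfields of algC generated by the
   finite sequences s and s ++ t, computed inside a number field containing them *)
Definition rel_degree (s t : seq algC) : nat :=
  let L := projT1 (num_field_exists (s ++ t)) in
  let s1 : seq L := sval (projT2 (projT2 (num_field_exists (s ++ t)))) in
  let Es : {vspace L} := <<1 & take (size s) s1>>%VS in
  let Est : {vspace L} := <<1 & s1>>%VS in
  (\dim_Es Est)%N.

(* Main.v *)
(** Let n be a multiple of the relevant orders, n = p^b m with m prime to p.
    By Galois theory the relative degree is the index in A, the group of units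
    u mod n with u = 1 mod p that fix chi, of the units that are 1 mod p^a; this
    index is shown to divide chi(1) by induction on |G|.  If some normal
    subgroup has a non-invariant constituent theta below chi, pass to the
    Clifford correspondent on the inertia group T: the index lost in A is the
    size of an orbit of A on the G-conjugates of theta, and these orbits all
    have the same size, so it divides |G : T|.  Otherwise let N be normal with
    G / N a p'-group or of order p, and theta below chi.  In the first case a
    unit that is 1 mod p m fixes chi if it fixes theta, so the level a does not
    change.  In the second case theta extends to chi, and a p-element u of the
    units with u = 1 mod p^b that fixes theta also fixes chi (see
    [fix_p'_factor]); splitting a unit into its parts mod p^b and mod m leaves
    a computation with units mod p^b, where the noncyclic case p = 2 is settled
    by the determinant of chi. *)

Require Import Defs.
From HB Require Import structures.
From mathcomp Require Import all_boot all_order all_algebra all_fingroup all_solvable all_field all_character.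
From mathcomp Require Import zify.
Set Implicit Arguments. Unset Strict Implicit. Unset Printing Implicit Defensive.
Import GroupScope GRing.Theory Num.Theory.

(** The obstacle is the step of index p. A unit fixing theta sends chi to lam chi with lam a linear
    character of G / N, and nothing about theta alone forces lam = 1. Powers by a unit u that is 1
    mod p^b fix all p-elements, so u fixes all characters of p-groups; the idea is to descend a
    series below N until only a p-group remains. Its p-factors are absorbed into the p-quotient on
    top. Each p'-factor N / M is crossed by looking at |chi|^2, which does not see lam and whose
    averages over cosets of M add up to |N / M|, prime to p. This descent needs homogeneous
    restrictions to all terms, hence a series of subgroups normal in G, whereas p-solvability is
    given by a subnormal one. Working over Q_p(chi), that is with units that are 1 mod p, makes
    these units fix lam, whose values are p-th roots of unity; so v^p fixes chi as soon as v fixes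
    theta, which disposes of the p'-part of v. *)

Lemma prime_index_sol (gT : finGroupType) (N D : {group gT}) : N <| D -> solvable (D / N) -> (D / N) != 1 ->
  exists H : {group gT}, [/\ N <| H, H <| D, prime #|D : H| & #|D : H| %| #|(D / N)|].
Proof.
move=> nsND solDN ntDN; have [H' nsH' prH'] := sol_prime_factor_exists solDN ntDN.
have [H Dq sNH nsHD] := inv_quotientN nsND nsH'.
have sHD := normal_sub nsHD.
have Di : #|(D / N) : H'| = #|D : H|.
  by rewrite Dq index_quotient_eq ?(normal_norm nsND) // subIset ?sNH ?orbT.
exists H; rewrite -Di; split; rewrite ?dvdn_indexg //.
by rewrite (normalS sNH sHD).
Qed.

(** * Series with p- and p'-factors, subnormal and normal *)

Inductive normal_pser (p : nat) (gT : finGroupType) (G : {group gT}) :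
  {group gT} -> Prop :=
| NormalPser1 : normal_pser p G 1%G
| NormalPserS (M N : {group gT}) : normal_pser p G M -> M \subset N -> N <| G ->
    p.-group (N / M)%g || p^'.-group (N / M)%g -> normal_pser p G N.

Lemma normal_pser_normal p gT (G N : {group gT}) : normal_pser p G N -> N <| G.
Proof. by case=> // *; apply: normal1. Qed.

Section PSolvable.

Variables (gT : finGroupType) (p : nat).
Implicit Types G H K L M N : {group gT}.

Lemma quotient_pi_elts (pi : nat_pred) H N x : H <| N -> pi.-group (N / H) ->
  x \in N -> pi^'.-elt x -> x \in H.
Proof.
move=> nsHN piNH Nx pi'x; have NHx := subsetP (normal_norm nsHN) x Nx.
rewrite coset_idr //; apply/eqP; rewrite -order_eq1; apply/eqP.
apply: (@pnat_1 pi); last by rewrite -/(p_elt _ _) morph_p_elt.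
by rewrite -/(p_elt _ _) (mem_p_elt piNH) ?mem_quotient.
Qed.

(** [R] is generated by the pi'-elements of [N]. They form a set stable under [G] and contained in
    [H]; modulo [R] every element of [N] agrees with its pi-part, so [N / R] is a pi-group. *)
Lemma residual_pgroup (pi : nat_pred) G H N : N <| G -> H <| N -> pi.-group (N / H) ->
  exists R : {group gT}, [/\ R <| G, R \subset H & pi.-group (N / R)].
Proof.
move=> nsNG nsHN piNH; pose A := [set x in N | pi^'.-elt x]; have [sNG nNG] := andP nsNG.
have sAH : <<A>> \subset H.
  rewrite gen_subG; apply/subsetP=> x; rewrite inE => /andP[Nx pi'x].
  exact: quotient_pi_elts nsHN piNH Nx pi'x.
have sAN : <<A>> \subset N := subset_trans sAH (normal_sub nsHN).
have nAG : G \subset 'N(<<A>>).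
  rewrite norms_gen //; apply/subsetP=> g Gg; rewrite inE; apply/subsetP=> _ /imsetP[x + ->].
  by rewrite !inE p_eltJ memJ_norm ?(subsetP nNG).
exists <<A>>%G; split=> //; first by rewrite /normal (subset_trans sAN).
apply/pgroupP=> q pr_q /(Cauchy pr_q)[Y NY oY].
have [x NAx Nx DY] := morphimP NY.
suff: pi.-elt Y by rewrite /p_elt oY pnatE.
have cA : coset <<A>> x.`_pi^' = 1.
  by rewrite coset_id // mem_gen // inE groupX //= p_elt_constt.
have: coset <<A>> (x.`_pi * x.`_pi^') = coset <<A>> x.`_pi.
  by rewrite morphM ?groupX //= cA mulg1.
by rewrite consttC /= DY /= => ->; rewrite morph_p_elt ?groupX // p_elt_constt.
Qed.

Inductive subnormal_pser : {group gT} -> Prop :=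
| SubnormalPser1 : subnormal_pser 1%G
| SubnormalPserS H K : subnormal_pser H -> H <| K ->
    p.-group (K / H) || p^'.-group (K / H) -> subnormal_pser K.

Lemma psolvable_subnormal_pser G : psolvable p G -> subnormal_pser G.
Proof.
case=> s []; elim/last_ind: s G => [|s K IHs] G /=; first by move=> _ <-; constructor.
rewrite rcons_path last_rcons => /andP[path_s /andP[nsHK pHK]] <-.
exact: SubnormalPserS (IHs _ path_s (erefl _)) nsHK pHK.
Qed.

Lemma subnormal_pserS H G : H \subset G -> subnormal_pser G -> subnormal_pser H.
Proof.
move=> sHG serG; elim: serG H sHG => [|M {}G serM IHM nsMG pGM] H sHG.
  by have /trivGP-> := sHG; constructor.
have sHMH : H :&: M \subset H by rewrite subsetIl.
apply: (@SubnormalPserS (H :&: M)%G) => //=.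
- by apply: IHM; rewrite subsetIr.
- exact: normalGI sHG nsMG.
have nMH : H \subset 'N(M) by rewrite (subset_trans sHG) ?normal_norm.
have sHMGM : H / M \subset G / M by rewrite quotientS.
rewrite setIC !(isog_pgroup _ (second_isog nMH)).
by case/orP: pGM => /(pgroupS sHMGM)->; rewrite ?orbT.
Qed.

Lemma subnormal_pser_proper G : subnormal_pser G -> G :!=: 1 ->
  exists H, [/\ subnormal_pser H, H <| G, H \proper G &
               p.-group (G / H) || p^'.-group (G / H)].
Proof.
elim=> [|H {}G serH IHH nsHG pGH ntG]; first by rewrite eqxx.
have [eqHG | neqHG] := eqVneq (H : {set gT}) G.
  by rewrite -(group_inj eqHG) in ntG *; apply: IHH.
by exists H; split; rewrite // properEneq neqHG normal_sub.
Qed.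

(** A term [H] that is normal only in [N] is replaced by the residual subgroup [R] of [N]: it is
    normal in [G], its quotient [N / R] is of the same kind, and it inherits a series as a subgroup
    of [H]. *)
Lemma subnormal_normal_pser G N : N <| G -> subnormal_pser N -> normal_pser p G N.
Proof.
have [m] := ubnP #|N|; elim: m N => // m IHm N /ltnSE-leNm nsNG serN.
have [/group_inj-> | ntN] := eqVneq (N : {set gT}) 1; first by constructor.
have [H [serH nsHN ltHN pNH]] := subnormal_pser_proper serN ntN.
have [R [nsRG sRH pNR]] : exists R : {group gT},
  [/\ R <| G, R \subset H & p.-group (N / R) || p^'.-group (N / R)].
- case/orP: pNH => /(residual_pgroup nsNG nsHN)[R [nsRG sRH pNR]]; exists R;
    by rewrite nsRG sRH pNR ?orbT.
apply: NormalPserS (subset_trans sRH (normal_sub nsHN)) nsNG pNR.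
apply: IHm nsRG (subnormal_pserS sRH serH).
by apply: leq_trans leNm; rewrite proper_card // (sub_proper_trans sRH).
Qed.

Lemma subnormal_pser_top G : prime p -> subnormal_pser G -> G :!=: 1 ->
  exists N : {group gT}, [/\ subnormal_pser N, N <| G, N \proper G &
    p^'.-group (G / N) || (#|G : N| == p)].
Proof.
move=> pr_p serG ntG; have [H [serH nsHG ltHG /orP[pGH | p'GH]]] := subnormal_pser_proper serG ntG.
  have ntGH : G / H != 1.
    by rewrite -subG1 quotient_sub1 ?normal_norm // proper_subn.
  have [N [nsHN nsNG prGN dvGN]] := prime_index_sol nsHG (pgroup_sol pGH) ntGH.
  exists N; split=> //.
  - exact: subnormal_pserS (normal_sub nsNG) serG.
  - by rewrite properE normal_sub // -indexg_gt1 prime_gt1.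
  by apply/orP; right; have := pnat_dvd dvGN pGH; rewrite pnatE.
by exists H; rewrite p'GH.
Qed.

End PSolvable.

(** * Units modulo n *)

Section PrimePowers.

Local Open Scope nat_scope.

Lemma modn_geom_sum p x d : x = 1 %[mod d] -> \sum_(i < p) x ^ i = p %[mod d].
Proof.
move=> x1; rewrite -[in RHS](card_ord p) -sum1_card -[LHS]modn_summ -[RHS]modn_summ.
congr (_ %% _); apply: eq_bigr => i _; rewrite -(modnXm i d x) x1 modnXm.
by rewrite exp1n.
Qed.

Lemma eqmod1_expn_prime p x d : prime p -> 0 < x -> x = 1 %[mod p] -> x = 1 %[mod d] ->
  x ^ p = 1 %[mod d * p].
Proof.
move=> pr_p x_gt0 x1p /eqP; rewrite eqn_mod_dvd // => dvdx; apply/eqP.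
rewrite eqn_mod_dvd ?expn_gt0 ?x_gt0 // subn1 predn_exp dvdn_mul //.
  by rewrite -subn1.
by apply/eqP; rewrite modn_geom_sum // modnn.
Qed.

(** Lifting the exponent: x^p - 1 is x - 1 times a geometric sum, and that sum is [p] times a number
    that is 1 mod p. For p = 2 and s = 1 this fails, as 3^2 - 1 = 8 shows. *)
Lemma logn_expn_prime p x s : prime p -> 0 < s -> ~~ ((p == 2) && (s == 1)) ->
  1 < x -> logn p x.-1 = s -> logn p (x ^ p).-1 = s.+1.
Proof.
move=> pr_p s_gt0 not21 x_gt1 vx.
have p_gt0 := prime_gt0 pr_p; pose y := x.-1; have Dx : x = y.+1 by rewrite prednK // ltnW.
have y_gt0 : 0 < y by rewrite -ltnS -Dx.
have dvdy : p ^ s %| y by rewrite pfactor_dvdn // vx.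
have dvpy : p %| y by apply: dvdn_trans dvdy; rewrite dvdn_exp.
have powE i : exists c, x ^ i = 1 + i * y + c * (y * y).
  elim: i => [|i [c IHi]]; first by exists 0.
  by exists (i + c + c * y); rewrite expnS IHi Dx; nia.
have [c Dc] : exists c, \sum_(i < p) x ^ i = p + 'C(p, 2) * y + c * (y * y).
  rewrite -bin2_sum big_mkord; elim: (p) => [|k [c IHk]].
    by exists 0; rewrite !big_ord0.
  have [d Dd] := powE k; exists (c + d); rewrite !big_ord_recr /= IHk Dd.
  move: (\sum_(i < k) _) => S; nia.
(* For odd [p], both the binomial coefficient and [y] are divisible by [p]; for p = 2 the
   coefficient is 1 and 4 must divide [y], which is where s = 1 is excluded. *)
have dvC : p * p %| 'C(p, 2) * y.
  have [odd_p | ] := boolP (odd p).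
    by rewrite dvdn_mul ?prime_dvd_bin // odd_gt2 // prime_gt1.
  move/(prime_oddPn pr_p)=> p2; rewrite {}p2 in dvdy not21 *; rewrite mul1n.
  case: s s_gt0 not21 dvdy {vx} => [|[|s]] // _ _; rewrite expnS expnS mulnA.
  by apply: dvdn_trans; apply: dvdn_mulr.
have [q Dq] : exists q, \sum_(i < p) x ^ i = p * (1 + p * q).
  have: p * p %| 'C(p, 2) * y + c * (y * y) by rewrite dvdn_add // dvdn_mull ?dvdn_mul.
  by case/dvdnP=> q Dq; exists q; rewrite Dc -addnA Dq; nia.
rewrite predn_exp Dq lognM ?muln_gt0 ?p_gt0 // -/y vx lognM // logn_prime // eqxx.
rewrite lognE [p %| _](_ : _ = false) ?andbF ?addn0 ?addn1 //.
by rewrite dvdn_addl ?dvdn_mulr // dvdn1; apply: gtn_eqF; apply: prime_gt1.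
Qed.

End PrimePowers.

Definition unat (n : nat) (u : {unit 'Z_n}) : nat := FinRing.uval u.

Lemma coprime_unitZ (n : nat) (u : {unit 'Z_n}) :
  coprime (unat u) (Zp_trunc n).+2.
Proof.
have:= valP u; rewrite -[X in X \is a _]natr_Zp.
by rewrite (@unitZpE (Zp_trunc n).+2) // coprime_sym.
Qed.

Section UnitResidues.

Variable n : nat.
Hypothesis n_gt1 : (1 < n)%N.
Implicit Types u v : {unit 'Z_n}.

Lemma coprime_unit u : coprime (unat u) n.
Proof. by have:= coprime_unitZ u; rewrite Zp_cast. Qed.

Lemma unat1 : unat (1%g : {unit 'Z_n}) = 1%N :> nat.
Proof. by []. Qed.

Lemma unatM u v :
  unat (u * v)%g = (unat u * unat v %% n)%N :> nat.
Proof. by rewrite -[RHS](congr1 (modn _) (Zp_cast n_gt1)). Qed.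

End UnitResidues.

(** * Congruence subgroups of the units *)

Section CongruenceSubgroups.

Local Open Scope nat_scope.

Variables (n : nat).
Hypotheses (n_gt1 : 1 < n).
Implicit Types (v w : {unit 'Z_n}) (d : nat).

(** For [d] dividing [n] this is the Galois group of Q_n over Q_d. It is a bare set so that [d] can
    be any expression; [ucongG] adds the group structure from a proof of divisibility. *)
Definition ucong d : {set {unit 'Z_n}} := [set v | unat v == 1 %[mod d]].

Lemma ltn_unat v : unat v < n.
Proof. by rewrite -[X in _ < X](Zp_cast n_gt1) ltn_ord. Qed.

Lemma unat_gt0 v : 0 < unat v.
Proof.
have := coprime_unit n_gt1 v; case: (unat v) => // /eqP.
by rewrite gcd0n => n1; move: n_gt1; rewrite n1.
Qed.

Lemma unatM_mod v w d : d %| n -> unat (v * w)%g = unat v * unat w %[mod d].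
Proof. by move=> dn; rewrite unatM // modn_dvdm. Qed.

Lemma unatX_mod v k d : d %| n -> unat (v ^+ k)%g = unat v ^ k %[mod d].
Proof.
move=> dn; elim: k => [|k IHk]; first by [].
by rewrite expgS expnS unatM_mod // -modnMmr IHk modnMmr.
Qed.

Lemma unat_inj : injective (@unat n).
Proof. by move=> v w /val_inj/val_inj. Qed.

Lemma unat_mod_inj v w : unat v = unat w %[mod n] -> v = w.
Proof. by rewrite !modn_small ?ltn_unat // => /unat_inj. Qed.

Lemma exists_unit k : coprime k n -> exists v : {unit 'Z_n}, unat v = k %[mod n].
Proof.
move=> co; have uk : (k%:R : 'Z_n)%R \is a GRing.unit.
  by rewrite unitZpE // coprime_sym.
exists (FinRing.unit 'Z_n uk); rewrite /unat /=.
by rewrite val_Zp_nat // modn_mod.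
Qed.

Section Divisor.

Variable d : nat.
Hypothesis dn : d %| n.

Lemma ucong_group_set : group_set (ucong d).
Proof.
apply/group_setP; split=> [|v w]; first by rewrite inE unat1.
rewrite !inE => /eqP v1 /eqP w1; rewrite unatM_mod //.
by rewrite -modnMml v1 modnMml mul1n w1.
Qed.

Definition ucongG : {group {unit 'Z_n}} := Group ucong_group_set.

Lemma eqmod_ucong v w : unat v = unat w %[mod d] <-> (v * w^-1)%g \in ucong d.
Proof.
split=> [eqvw | vw]; last first.
  rewrite -{1}(mulgKV w v) unatM_mod // -modnMml; move: vw; rewrite inE => /eqP->.
  by rewrite modnMml mul1n.
by rewrite inE unatM_mod // -modnMml eqvw modnMml -unatM_mod // mulgV unat1.
Qed.

End Divisor.

Lemma ucongS d e : d %| e -> ucong e \subset ucong d.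
Proof.
move=> de; apply/subsetP=> v; rewrite !inE => /eqP v1; apply/eqP.
by rewrite -(modn_dvdm _ de) v1 modn_dvdm.
Qed.

Lemma ucong_n v : (v \in ucong n) = (v == 1%g).
Proof.
rewrite inE; apply/eqP/eqP=> [v1|->]; last by rewrite unat1.
by apply: unat_mod_inj; rewrite v1 unat1.
Qed.

Lemma ucong_lcm a b v : coprime a b -> v \in ucong a -> v \in ucong b ->
  v \in ucong (a * b).
Proof. by move=> co; rewrite !inE chinese_remainder // => -> ->. Qed.

Lemma ucong_factor a b v : n = a * b -> coprime a b ->
  exists w, [/\ w \in ucong b, unat v = unat w %[mod a] & (v * w^-1)%g \in ucong a].
Proof.
move=> Dn co; have an : a %| n by rewrite Dn dvdn_mulr.
have bn : b %| n by rewrite Dn dvdn_mull.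
pose k := chinese a b (unat v) 1.
have ka : k = unat v %[mod a] by apply: chinese_modl.
have kb : k = 1 %[mod b] by apply: chinese_modr.
have cok : coprime k n.
  rewrite Dn coprimeMr -coprime_modl ka coprime_modl -coprime_modl.
  rewrite coprime_modl (coprime_dvdr an (coprime_unit n_gt1 v)) /=.
  by rewrite -coprime_modl kb coprime_modl coprime1n.
have [w Dw] := exists_unit cok; exists w.
have wa : unat v = unat w %[mod a] by rewrite -(modn_dvdm (unat w) an) Dw modn_dvdm.
split=> //; last exact/(eqmod_ucong an).
by rewrite inE -(modn_dvdm _ bn) Dw modn_dvdm // kb.
Qed.

Section PrimePower.

Variables (p b m : nat).
Hypotheses (pr_p : prime p) (Dn : n = p ^ b * m) (co_pm : coprime p m).

Let p_gt0 := prime_gt0 pr_p.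
Let n_gt0 : 0 < n. Proof. exact: ltnW. Qed.
Let m_gt0 : 0 < m. Proof. by move: n_gt0; rewrite Dn muln_gt0 => /andP[]. Qed.

Lemma dvd_pm s : s <= b -> p ^ s * m %| n.
Proof. by move=> le_sb; rewrite Dn dvdn_mul ?dvdn_exp2l. Qed.

Lemma ucong_pexp v s : 0 < s -> v \in ucong (p ^ s * m) ->
  s < b -> (v ^+ p)%g \in ucong (p ^ s.+1 * m).
Proof.
move=> s_gt0; rewrite !inE => /eqP v1 lt_sb.
rewrite unatX_mod ?dvd_pm // expnS -mulnA mulnC; apply/eqP.
apply: eqmod1_expn_prime; rewrite ?unat_gt0 //.
have dv : p %| p ^ s * m by rewrite dvdn_mulr ?dvdn_exp.
by rewrite -(modn_dvdm _ dv) v1 modn_dvdm.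
Qed.

Lemma ucong_pelt v s : 0 < s <= b -> v \in ucong (p ^ s * m) -> p.-elt v.
Proof.
move=> /andP[s_gt0 le_sb] v1.
suff: (v ^+ (p ^ (b - s)))%g = 1%g.
  by move/eqP; rewrite -order_dvdn => /pnat_dvd; apply; rewrite pnatX pnat_id.
suff: (v ^+ (p ^ (b - s)))%g \in ucong n by rewrite ucong_n => /eqP.
rewrite [X in ucong X]Dn.
have [k Dk] : exists k, k = b - s by exists (b - s).
have Ds : s = b - k by rewrite Dk subKn.
rewrite -Dk; have lekb : k < b by rewrite Dk ltn_subrL s_gt0 (leq_trans s_gt0).
elim: k s v {Dk le_sb} Ds lekb s_gt0 v1 => [|k IHk] s v Ds lekb s_gt0 v1.
  by rewrite expg1; rewrite Ds subn0 in v1.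
have [Ds1 lt_sb] : s.+1 = b - k /\ s < b by lia.
by rewrite expnS expgM (IHk s.+1) ?ucong_pexp // ltnW.
Qed.

(** Such a unit is 1 + q p^s m with q < p^(b - s). *)
Lemma card_ucong s : s <= b -> #|ucong (p ^ s * m)| <= p ^ (b - s).
Proof.
move=> le_sb; have d_gt0 : 0 < p ^ s * m by rewrite muln_gt0 expn_gt0 p_gt0.
have lt_q v : (unat v).-1 %/ (p ^ s * m) < p ^ (b - s).
  rewrite ltn_divLR // mulnA -expnD subnK // -Dn.
  by rewrite (leq_ltn_trans (leq_pred _)) ?ltn_unat.
pose f v : 'I_(p ^ (b - s)) := Ordinal (lt_q v).
rewrite -[X in _ <= X]card_ord -(card_in_imset (f := f)) ?max_card //.
move=> v w; rewrite !inE !eqn_mod_dvd ?unat_gt0 // !subn1 => dv dw [eq_q].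
apply: unat_inj; rewrite -[unat v]prednK ?unat_gt0 // -[unat w]prednK ?unat_gt0 //.
by rewrite -(divnK dv) eq_q divnK.
Qed.

Lemma logn_unatX v s k : 0 < s -> ~~ ((p == 2) && (s == 1)) ->
  1 < unat v -> logn p (unat v).-1 = s -> logn p (unat v ^ (p ^ k)).-1 = s + k.
Proof.
move=> s_gt0 not21 v_gt1 vs; elim: k => [|k IHk]; first by rewrite expn1 addn0.
rewrite expnSr expnM (@logn_expn_prime _ _ (s + k)) ?addnS //.
- by rewrite addn_gt0 s_gt0.
- by apply: contra not21 => /andP[-> ]; case: s s_gt0 {vs IHk} => [|[|s]].
by rewrite -(exp1n (p ^ k)) ltn_exp2r // expn_gt0 p_gt0.
Qed.

(** The p-adic valuation of v^(p^e) - 1 is s + e, so [v] has order at least p^(b - s), which bounds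
    the size of the congruence subgroup. *)
Lemma ucong_cycle v s : 0 < s -> ~~ ((p == 2) && (s == 1)) -> s < b ->
    v \in ucong (p ^ s * m) -> v \notin ucong (p ^ s.+1) ->
  ucong (p ^ s * m) = <[v]>.
Proof.
move=> s_gt0 not21 lt_sb v1 nv1; have le_sb := ltnW lt_sb.
have vp : p.-elt v by apply: (@ucong_pelt v s); rewrite ?s_gt0.
have v_gt1 : 1 < unat v.
  rewrite ltn_neqAle unat_gt0 andbT eq_sym; apply: contra nv1 => /eqP v_1.
  by rewrite inE v_1.
have vs : logn p (unat v).-1 = s.
  apply/eqP; rewrite eqn_leq leqNgt -!pfactor_dvdn ?ltn_predRL //.
  move: v1 nv1; rewrite !inE !eqn_mod_dvd ?unat_gt0 // !subn1 => dvv ->.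
  by apply: dvdn_trans dvv; apply: dvdn_mulr.
apply/eqP; rewrite eq_sym eqEcard (leq_trans (card_ucong le_sb)) ?andbT //.
  by rewrite -[ucong _]/(gval (ucongG (dvd_pm le_sb))) cycle_subG.
rewrite -orderE; have [e De] := p_natP vp; rewrite De leq_exp2l ?prime_gt1 //.
have: (v ^+ (p ^ e))%g \in ucong n by rewrite ucong_n -De expg_order.
rewrite inE unatX_mod // eqn_mod_dvd ?expn_gt0 ?unat_gt0 // subn1 => dv.
have: p ^ b %| (unat v ^ (p ^ e)).-1 by apply: dvdn_trans dv; rewrite Dn dvdn_mulr.
rewrite pfactor_dvdn //; first by rewrite (logn_unatX _ _ not21 v_gt1 vs) // leq_subLR.
by rewrite ltn_predRL -(exp1n (p ^ e)) ltn_exp2r // expn_gt0 p_gt0.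
Qed.

(** If [v] is not 1 mod p^j, then for some t < j it is 1 mod p^t but not mod p^(t+1), and generates
    [ucong (p ^ t * m)]. That group then lies in [K] and contains [ucong (p ^ j.-1 * m)], a
    contradiction. *)
Lemma ucong_gap (K : {group {unit 'Z_n}}) v s j : 0 < s -> ~~ ((p == 2) && (s == 1)) ->
    j <= b -> v \in K -> v \in ucong (p ^ s * m) ->
    ~~ (ucong (p ^ j.-1 * m) \subset K) ->
  v \in ucong (p ^ j).
Proof.
move=> s_gt0 not21 le_jb Kv v1; apply: contraR => nvj.
have [le_js | lt_sj] := leqP j s.
  case/negP: nvj; apply: (subsetP (ucongS _)) v1.
  by rewrite dvdn_mulr // dvdn_exp2l.
have ex_t : exists t, v \notin ucong (p ^ t) by exists j.
case: (ex_minnP ex_t) => t nvt min_t.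
have le_tj : t <= j by apply: min_t.
have lt_st : s < t.
  rewrite ltnNge; apply: contra nvt => le_ts; apply: (subsetP (ucongS _)) v1.
  by rewrite dvdn_mulr // dvdn_exp2l.
case: t => // t in nvt min_t le_tj lt_st *.
have vt : v \in ucong (p ^ t).
  by apply: contraT => /min_t; rewrite ltnn.
have vtm : v \in ucong (p ^ t * m).
  apply: ucong_lcm vt _; first by rewrite coprimeXl.
  by apply: (subsetP (ucongS _)) v1; rewrite dvdn_mull.
have t_gt0 : 0 < t by apply: leq_trans s_gt0 _.
have lt_tb : t < b by apply: leq_trans le_jb.
have not21t : ~~ ((p == 2) && (t == 1)).
  apply: contra not21 => /andP[-> /eqP t1].
  by rewrite eqn_leq s_gt0 andbT -ltnS -t1.
apply: (@subset_trans _ _ (mem (ucong (p ^ t * m)))).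
  by apply: ucongS; rewrite dvdn_mul // dvdn_exp2l // -ltnS prednK // (leq_trans _ lt_sj).
by rewrite (@ucong_cycle v) // cycle_subG.
Qed.

End PrimePower.

End CongruenceSubgroups.

Local Open Scope ring_scope.

(** * Galois action on characters *)

(** The unit determines this automorphism only on the field of n-th roots of unity; beyond it the
    extension is arbitrary, so multiplicativity in [u] is stated on characters only. *)
Definition gal (n : nat) (u : {unit 'Z_n}) : {rmorphism algC -> algC} :=
  sval (Qn_aut_exists (coprime_unitZ u)).

(* By cfAut_galE, conjugating a character by gal u amounts to composing it with
   this power map. *)
Definition expU (gT : finGroupType) (n : nat) (x : gT) (u : {unit 'Z_n}) : gT :=
  (x ^+ unat u)%g.

Section GalAction.

Variable n : nat.
Hypothesis n_gt1 : (1 < n)%N.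
Implicit Types u v : {unit 'Z_n}.

Lemma galE u z : z ^+ n = 1 -> gal u z = z ^+ unat u.
Proof.
by move=> zn; rewrite /gal; case: Qn_aut_exists => f /= ->; rewrite ?Zp_cast.
Qed.

Section Exponent.

Variable gT : finGroupType.
Hypothesis gTn : (#|[set: gT]| %| n)%N.

Lemma expgn1 (x : gT) : (x ^+ n = 1)%g.
Proof.
by apply/eqP; rewrite -order_dvdn (dvdn_trans _ gTn) // order_dvdG ?inE.
Qed.

Lemma expUM (x : gT) u v : expU x (u * v)%g = expU (expU x u) v.
Proof.
rewrite /expU -expgM; apply/eqP; rewrite eq_expg_mod_order (unatM n_gt1) modn_dvdm //.
by rewrite order_dvdn expgn1.
Qed.

Lemma expU_is_action : is_action [set: {unit 'Z_n}] (@expU gT n).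
Proof.
split=> [u x y exy | x u v _ _]; last exact: expUM.
by rewrite -[x]expg1 -[y]expg1 -(unat1 n) -(mulgV u) -!/(expU _ _) !expUM exy.
Qed.

Canonical expU_action := Action expU_is_action.

(** On the cyclic group generated by [x] the character is a sum of linear characters, whose values
    are n-th roots of unity. *)
Lemma cfAut_galE (G : {group gT}) (phi : 'CF(G)) u x :
  phi \is a character -> cfAut (gal u) phi x = phi (expU x u).
Proof.
move=> Nphi; have [Gx | notGx] := boolP (x \in G); last first.
  rewrite !cfun0 ?rmorph0 //; apply: contra notGx => Gxu.
  have ->: x = expU (expU x u) u^-1 by rewrite -expUM mulgV /expU expg1.
  by rewrite /expU groupX.
have sxG: <[x]> \subset G by rewrite cycle_subG.
rewrite /expU cfunE -!(cfResE _ sxG) ?mem_cycle ?cycle_id //.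
have /char_sum_irr[r ->] := cfRes_char <[x]> Nphi.
rewrite !sum_cfunE rmorph_sum; apply: eq_bigr => i _.
have Li: 'chi_i \is a linear_char by rewrite irr_cyclic_lin ?cycle_cyclic.
rewrite lin_charX ?cycle_id // galE //.
by rewrite -lin_charX ?cycle_id // expgn1 lin_char1.
Qed.

Lemma cfAut_galM (G : {group gT}) (phi : 'CF(G)) u v :
  phi \is a character -> cfAut (gal (u * v)%g) phi = cfAut (gal u) (cfAut (gal v) phi).
Proof.
move=> Nphi; apply/cfunP => x.
rewrite cfAut_galE // [RHS]cfAut_galE ?cfAut_char //.
by rewrite cfAut_galE // -expUM.
Qed.

Lemma cfAut_gal1 (G : {group gT}) (phi : 'CF(G)) :
  phi \is a character -> cfAut (gal (1%g : {unit 'Z_n})) phi = phi.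
Proof. by move=> Nphi; apply/cfunP => x; rewrite cfAut_galE // /expU expg1. Qed.

Definition galIirr (G : {group gT}) (i : Iirr G) u : Iirr G := aut_Iirr (gal u) i.

Lemma galIirr_is_action (G : {group gT}) :
  is_action [set: {unit 'Z_n}] (@galIirr G).
Proof.
split=> [u | i u v _ _]; first exact: aut_Iirr_inj.
apply: irr_inj; rewrite /galIirr !aut_IirrE unit_Zp_mulgC cfAut_galM ?irr_char //.
Qed.

End Exponent.
End GalAction.

(** * Clifford theory for restrictions *)

Section Restriction.

Variable gT : finGroupType.
Implicit Types G H N : {group gT}.

Lemma constt_Res_conjg G N (i : Iirr G) (j k : Iirr N) :
    N <| G -> j \in irr_constt ('Res[N] 'chi_i) ->
  k \in irr_constt ('Res[N] 'chi_i) -> exists2 y, y \in G & 'chi_k = ('chi_j ^ y)%CF.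
Proof.
move=> nsNG jR kR; suff /cfclassP: 'chi_k \in ('chi_j ^: G)%CF by [].
apply: contraLR kR => notk; rewrite irr_consttE negbK.
rewrite (Clifford_Res_sum_cfclass nsNG jR) cfdotZl cfdot_suml big1_seq ?mulr0 //.
move=> psi /andP[_ psij]; have [y _ Dpsi] := cfclassP _ _ _ psij.
rewrite Dpsi -conjg_IirrE cfdot_irr; case: eqP => // Dk.
by rewrite -Dk conjg_IirrE -Dpsi psij in notk.
Qed.

(** If the restriction is a sum of |G : N| distinct constituents, these are conjugate of equal
    degree; inducing one of them gives a character containing chi_i and of the same degree. *)
Lemma Res_prime_irr_or_Ind G N (i : Iirr G) : N <| G -> prime #|G : N| ->
  'Res[N] 'chi_i \in irr N \/
  {in irr_constt ('Res[N] 'chi_i), forall j, 'Ind[G] 'chi_j = 'chi_i}.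
Proof.
move=> nsNG pr; have [sNG _] := andP nsNG.
have [|[c injc Dres]] := cfRes_prime_irr_cases i nsNG (erefl _) pr; first by left.
right=> j jR.
have /constt_charP[|phi Nphi Dphi] : i \in irr_constt ('Ind[G] 'chi_j).
- by rewrite constt_Ind_Res.
- by rewrite cfInd_char ?irr_char.
suff /eqP phi0: phi == 0 by rewrite Dphi phi0 addr0.
rewrite -char1_eq0 //; move/(congr1 (fun f : 'CF(G) => f 1%g)): Dphi.
rewrite cfInd1 // cfunE -(cfResE _ sNG) // Dres sum_cfunE.
rewrite (eq_bigr (fun=> 'chi_j 1%g)) => [|k _].
  by rewrite sumr_const card_ord mulr_natl => /esym/(canRL (addKr _))->; rewrite addNr.
have kR: c k \in irr_constt ('Res[N] 'chi_i).
  rewrite Dres irr_consttE cfdot_suml (bigD1 k) //= cfdot_irr eqxx.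
  rewrite big1 ?addr0 ?oner_eq0 // => l neq; rewrite cfdot_irr.
  by rewrite (inj_eq injc) (negPf neq).
by have [y _ ->] := constt_Res_conjg nsNG jR kR; rewrite cfConjg1.
Qed.

(** Gallagher: the constituents of the character induced from the common irreducible restriction are
    the products of chi_i with the irreducible characters of G / N. *)
Lemma irr_ext_mul G N (i j : Iirr G) :
    N <| G -> 'Res[N] 'chi_i \in irr N -> 'Res[N] 'chi_j = 'Res[N] 'chi_i ->
  exists l : Iirr (G / N), 'chi_j = 'chi_(mod_Iirr l) * 'chi_i.
Proof.
move=> nsNG /irrP[t Dt] eqR; have [irrM _ /(_ j) + _] := constt_Ind_ext nsNG Dt.
rewrite constt_Ind_Res eqR Dt constt_irr inE eqxx => /esym/codomP[l ->].
by exists l; rewrite cfIirrE.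
Qed.

Lemma constt_Res_Res G H N (chi : 'CF(G)) j :
    N \subset H -> H \subset G -> chi \is a character ->
    j \in irr_constt ('Res[N] chi) ->
  exists2 k, k \in irr_constt ('Res[H] chi) & j \in irr_constt ('Res[N] 'chi_k).
Proof.
move=> sNH sHG Nchi; rewrite -(cfResRes _ sNH sHG).
rewrite {1}[_ chi](cfun_sum_constt _) linear_sum irr_consttE cfdot_suml => nz.
apply/exists_inP; apply: contraR nz => /exists_inPn nz.
rewrite big1 // => k kR; rewrite linearZ cfdotZl; have:= nz k kR.
by rewrite irr_consttE negbK => /eqP->; rewrite mulr0.
Qed.

End Restriction.

(** * Constituents fixed by a Galois automorphism *)

Section FixedConstituents.

Variables (n : nat) (gT : finGroupType).
Hypotheses (n_gt1 : (1 < n)%N) (gTn : (#|[set: gT]| %| n)%N).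
Implicit Types (u : {unit 'Z_n}) (G H K N D : {group gT}).

(** Asking for each constituent to be fixed, and not only their sum, makes the property pass to
    constituents of [chi] on intermediate groups. *)
Definition fixRes u G (chi : 'CF(G)) H : Prop :=
  {in irr_constt ('Res[H] chi), forall j, cfAut (gal u) 'chi_j = 'chi_j}.

Lemma fixRes_cfAut u G (chi : 'CF(G)) H : chi \is a character ->
  fixRes u chi H -> cfAut (gal u) ('Res[H] chi) = 'Res[H] chi.
Proof.
move=> Nchi fixH; rewrite {2}['Res[H] chi]cfun_sum_constt.
rewrite ['Res[H] chi in LHS]cfun_sum_constt raddf_sum; apply: eq_bigr => j jR /=.
by rewrite cfAutZ_Cnat ?fixH // Cnat_cfdot_char_irr ?cfRes_char.
Qed.

Lemma fixRes_Res u G H (chi : 'CF(G)) j K : K \subset H -> H \subset G ->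
    chi \is a character -> j \in irr_constt ('Res[H] chi) ->
  fixRes u chi K -> fixRes u 'chi_j K.
Proof.
move=> sKH sHG Nchi jR fixK k kR; apply: fixK.
by rewrite -(cfResRes _ sKH sHG) (constt_Res_trans _ jR) ?cfRes_char.
Qed.

Lemma fixRes_id u G (i : Iirr G) : fixRes u 'chi_i G <-> cfAut (gal u) 'chi_i = 'chi_i.
Proof.
rewrite /fixRes cfRes_id; split=> [->//|fix_i j].
  by rewrite constt_irr inE.
by rewrite constt_irr inE => /eqP->.
Qed.

(** A constituent and its Galois conjugate are compared one element at a time. Taking [H] generated
    by [N] and one element reduces a quotient D / N to cyclic ones. *)
Lemma fixRes_local u G (chi : 'CF(G)) D : chi \is a character -> D \subset G ->
    (forall x, x \in D -> exists H, [/\ H \subset D, x \in H & fixRes u chi H]) ->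
  fixRes u chi D.
Proof.
move=> Nchi sDG locD j jR; apply/cfun_inP => x Dx.
have [H [sHD Hx fixH]] := locD x Dx.
have:= fixRes_cfAut (irr_char j) (fixRes_Res sHD sDG Nchi jR fixH).
move/(congr1 (fun f : 'CF(H) => f x)).
by rewrite /= [X in X = _ -> _]cfunE cfResE // => fix_x; rewrite cfunE.
Qed.

Lemma cfAut_gal_twistX u G (chi lam : 'CF(G)) k :
    chi \is a character -> cfAut (gal u) chi = lam * chi ->
    cfAut (gal u) lam = lam ->
  cfAut (gal (u ^+ k)%g) chi = lam ^+ k * chi.
Proof.
move=> Nchi Dchi Dlam; elim: k => [|k IHk]; first by rewrite cfAut_gal1 ?mul1r.
by rewrite expgS cfAut_galM // IHk rmorphM rmorphXn /= Dlam Dchi exprSr mulrA.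
Qed.

Lemma mod_Iirr_linear N G (l : Iirr (G / N)) : N <| G -> abelian (G / N) ->
  'chi_(mod_Iirr l) \is a linear_char.
Proof.
move=> nsNG abGN; rewrite mod_IirrE // cfMod_lin_char //.
exact/char_abelianP.
Qed.

Lemma mod_lin_kerE N G (lam : 'CF(G)) x y : lam \is a linear_char ->
  N \subset cfker lam -> x \in G -> (x^-1 * y)%g \in N -> lam y = lam x.
Proof.
move=> Llam sNk Gx Nxy; rewrite -{1}(mulKVg x y) lin_charM //; last first.
  by apply: (subsetP (cfker_sub lam)); apply: (subsetP sNk).
by rewrite (cfker1 (subsetP sNk _ Nxy)) lin_char1 ?mulr1.
Qed.

Lemma mod_Iirr_ker N G (l : Iirr (G / N)) : N <| G -> N \subset cfker 'chi_(mod_Iirr l).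
Proof. by move=> nsNG; rewrite mod_IirrE // cfker_mod. Qed.

Lemma lin_char_expg_index N G (lam : 'CF(G)) x : N <| G ->
    lam \is a linear_char -> N \subset cfker lam -> x \in G ->
  lam x ^+ #|G : N| = 1.
Proof.
move=> nsNG Llam sNk Gx; rewrite -lin_charX //.
have Nx: (x ^+ #|G : N|)%g \in N.
  rewrite -(card_quotient (normal_norm nsNG)).
  have NGx := subsetP (normal_norm nsNG) x Gx.
  rewrite coset_idr ?groupX // morphX //.
  by apply/eqP; rewrite -order_dvdn order_dvdG ?mem_quotient.
by rewrite (cfker1 (subsetP sNk _ Nx)) lin_char1.
Qed.

Section PrimePower.

Variables (p : nat) (u : {unit 'Z_n}).
Hypotheses (p_u : p.-elt u).

(** In the irreducible case chi^u = lam chi, with lam fixed because [u] acts trivially on D / N.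
    Iterating over the order of [u] gives lam^#[u] chi = chi; where chi(x) is not 0, the order of
    lam(x) divides both a power of [p] and the prime |D : N|, which is not [p]. *)
Lemma fix_prime_p' D N (i : Iirr D) : N <| D -> prime #|D : N| -> #|D : N| != p ->
    (forall x, x \in D -> (x^-1 * expU x u)%g \in N) ->
  fixRes u 'chi_i N -> cfAut (gal u) 'chi_i = 'chi_i.
Proof.
move=> nsND pr neqp actN fixN; have [sND nND] := andP nsND.
have [irrN | IndN] := Res_prime_irr_or_Ind i nsND pr; last first.
  have [j jR] := constt_cfRes_irr N i.
  by rewrite -(IndN j jR) cfAutInd fixN.
have abDN: abelian (D / N) by rewrite cyclic_abelian ?prime_cyclic ?card_quotient.
rewrite -aut_IirrE.
have [|l Dl] := @irr_ext_mul _ D N i (aut_Iirr (gal u) i) nsND irrN.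
  by rewrite aut_IirrE -cfAutRes fixRes_cfAut ?irr_char.
rewrite Dl; set lam := 'chi_(mod_Iirr l) in Dl *.
have Llam: lam \is a linear_char by apply: mod_Iirr_linear.
have kerlam: N \subset cfker lam by apply: mod_Iirr_ker.
rewrite aut_IirrE in Dl; apply/cfun_inP => x Dx; rewrite cfunE.
have [-> | nz] := eqVneq ('chi_i x) 0; first by rewrite mulr0.
have Dlam: cfAut (gal u) lam = lam.
  apply/cfun_inP => y Dy; rewrite cfAut_galE ?lin_charW //.
  by rewrite (mod_lin_kerE Llam kerlam Dy) ?actN.
have:= cfAut_gal_twistX #[u] (irr_char i) Dl Dlam.
rewrite expg_order cfAut_gal1 ?irr_char //.
move/(congr1 (fun f : 'CF(D) => f x)); rewrite cfunE exp_cfunE //.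
rewrite -[LHS]mul1r => /(mulIf nz) lamu.
have lamq := lin_char_expg_index nsND Llam kerlam Dx.
suff ->: lam x = 1 by rewrite mul1r.
have co: coprime #[u] #|D : N|.
  have [-> | nt] := eqVneq #[u] 1%N; first by rewrite coprime1n.
  rewrite coprime_sym prime_coprime //; apply: contra neqp => /pnat_dvd/(_ p_u).
  by rewrite pnatE.
have [a b Dab _]:= egcdnP #|D : N| (order_gt0 u).
have:= congr1 (fun k => lam x ^+ k) Dab; rewrite (eqP co) exprD expr1.
by rewrite mulnC exprM -lamu expr1n mulnC exprM lamq expr1n mul1r => /esym.
Qed.

End PrimePower.

End FixedConstituents.

Section CoprimeStep.

Variables (n : nat) (gT : finGroupType).
Hypotheses (n_gt1 : (1 < n)%N) (gTn : (#|[set: gT]| %| n)%N).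
Variables (p : nat) (u : {unit 'Z_n}).
Hypotheses (p_u : p.-elt u).
Implicit Types (G H K N D : {group gT}).

Lemma fixRes_sol_p' G (chi : 'CF(G)) D N : chi \is a character -> D \subset G ->
    N <| D -> solvable (D / N)%g -> p^'.-group (D / N)%g ->
    (forall x, x \in D -> (x^-1 * expU x u)%g \in N) ->
  fixRes u chi N -> fixRes u chi D.
Proof.
move=> Nchi; have [m] := ubnP #|D|; elim: m D => // m IHm D /ltnSE-leDm sDG nsND.
move=> solDN p'DN actN fixN.
have [DN1 | ntDN] := eqVneq (D / N)%g 1%g.
  suff ->: D = N by [].
  apply: group_inj; apply/eqP; rewrite eqEsubset (normal_sub nsND) andbT.
  by rewrite -(quotient_sub1 (normal_norm nsND)) DN1 subxx.
have [H [nsNH nsHD prDH dvDH]] := prime_index_sol nsND solDN ntDN.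
have sHD := normal_sub nsHD.
have fixH: fixRes u chi H.
  apply: IHm => //.
  - apply: leq_trans leDm; rewrite proper_card // properE sHD -indexg_gt1.
    exact: prime_gt1.
  - exact: subset_trans sDG.
  - exact: solvableS (quotientS _ sHD) solDN.
  - exact: pgroupS (quotientS _ sHD) p'DN.
  by move=> x Hx; rewrite actN // (subsetP sHD).
move=> j jR; apply: (fix_prime_p' n_gt1 gTn p_u nsHD prDH).
- apply: contraTneq p'DN => Dp; rewrite /pgroup.
  apply/negP=> /(pnat_dvd dvDH); rewrite pnatE // Dp inE /= inE eqxx //.
- by move=> x Dx; rewrite (subsetP (normal_sub nsNH)) ?actN.
exact: fixRes_Res jR fixH.
Qed.

Lemma fixRes_p' G (chi : 'CF(G)) D N : chi \is a character -> D \subset G ->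
    N <| D -> p^'.-group (D / N)%g ->
    (forall x, x \in D -> (x^-1 * expU x u)%g \in N) ->
  fixRes u chi N -> fixRes u chi D.
Proof.
move=> Nchi sDG nsND p'DN actN fixN; have [sND nND] := andP nsND.
apply: fixRes_local => // x Dx; exists (N <*> <[x]>)%G.
have sxD : N <*> <[x]> \subset D by rewrite join_subG sND cycle_subG.
split=> //; first by rewrite (subsetP (joing_subr _ _)) ?cycle_id.
apply: (@fixRes_sol_p' _ _ _ N) => //.
- exact: subset_trans sDG.
- exact: normalS (joing_subl _ _) sxD nsND.
- rewrite /= quotientYidl ?cycle_subG ?(subsetP nND) //.
  by rewrite abelian_sol // quotient_abelian // cycle_abelian.
- exact: pgroupS (quotientS _ sxD) p'DN.
by move=> y Hy; rewrite actN // (subsetP sxD).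
Qed.

End CoprimeStep.

(** * Sums over cosets of a normal subgroup *)

Section CosetAverage.

Variable gT : finGroupType.
Implicit Types (N D : {group gT}).

(* The coefficients on the right are natural numbers for a character alpha,
   hence the integrality of coset averages. *)
Lemma sum_rcoset_abelian N D (alpha : 'CF(D)) x : N <| D -> abelian (D / N)%g ->
    x \in D ->
  \sum_(y in N :* x) alpha y
    = #|N|%:R * \sum_(l : Iirr (D / N)) '[alpha, 'chi_(mod_Iirr l)] * 'chi_(mod_Iirr l) x.
Proof.
move=> nsND abDN Dx; have [sND nND] := andP nsND.
(* Column orthogonality in the abelian group D / N expresses the indicator of [N :* x] through
   linear characters. *)
have ind y : y \in D ->
    \sum_(l : Iirr (D / N)) 'chi_(mod_Iirr l) x * ('chi_(mod_Iirr l) y)^*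
     = #|D : N|%:R *+ (y \in N :* x).
  move=> Dy; have [NDx NDy] := (subsetP nND x Dx, subsetP nND y Dy).
  transitivity (\sum_i 'chi[D / N]_i (coset N x) * ('chi_i (coset N y))^*).
    by apply: eq_bigr => l _; rewrite mod_IirrE // !cfModE.
  rewrite second_orthogonality_relation ?mem_quotient //.
  have ->: coset N y ^: (D / N)%G = [set coset N y].
    apply/setP=> z; rewrite inE; apply/imsetP/eqP=> [[w Dw ->]|->].
      by rewrite conjgE (centsP abDN _ (mem_quotient _ Dy) _ Dw) mulKg.
    by exists 1%g; rewrite ?conjg1.
  rewrite inE eq_sym (sameP eqP (rcoset_kercosetP NDy NDx)).
  rewrite -card_quotient //; congr (_%:R *+ _).
  rewrite ['C_ _[_]](setIidPl _) // sub_cent1.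
  exact: (subsetP abDN) (mem_quotient _ Dx).
transitivity (#|D : N|%:R^-1 * \sum_(y in D) alpha y * (#|D : N|%:R *+ (y \in N :* x))).
  rewrite mulr_sumr [RHS](bigID (mem (N :* x))) /= [X in _ = _ + X]big1 ?addr0.
    rewrite [RHS](eq_bigl (mem (N :* x))).
      apply: eq_bigr => y ->; rewrite mulrCA mulVf ?mulr1 //.
      by rewrite pnatr_eq0 -lt0n.
    move=> y /=; apply: andb_idl => /rcosetP[z Nz ->].
    by rewrite groupM // (subsetP sND).
  by move=> y /andP[_ /negPf->]; rewrite !mulr0.
transitivity (#|D : N|%:R^-1 * \sum_(l : Iirr (D / N)) 'chi_(mod_Iirr l) x *
   (\sum_(y in D) alpha y * ('chi_(mod_Iirr l) y)^*)).
  congr (_ * _); under eq_bigr => y Dy do rewrite -ind // mulr_sumr.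
  rewrite exchange_big; apply: eq_bigr => l _.
  by rewrite mulr_sumr; apply: eq_bigr => y _; rewrite mulrCA.
rewrite !mulr_sumr; apply: eq_bigr => l _.
have [nzN nzi] : #|N|%:R != 0 :> algC /\ #|D : N|%:R != 0 :> algC.
  by rewrite !pnatr_eq0 -!lt0n.
by rewrite cfdotE -(Lagrange sND) natrM invfM !mulrA mulfV // mul1r mulrAC.
Qed.

End CosetAverage.

(** Orbits of length 1 contribute 0; every other orbit has length divisible by [p] and contributes
    that multiple of an algebraic integer. *)
Lemma dvdA_sum_pgroup_orbits (aT : finGroupType) (P : {group aT}) (T : finType)
    (to : {action aT &-> T}) (S : {set T}) (s : T -> algC) (p : nat) :
    p.-group P -> [acts P, on S | to] ->
    {in S & P, forall x a, s (to x a) = s x} ->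
    {in S, forall x, s x \in Aint} ->
    {in S, forall x, {in P, forall a, to x a = x} -> s x = 0} ->
  (p %| \sum_(x in S) s x)%A.
Proof.
move=> pP actP invs intS fix0.
have /and3P[/eqP defS tiS _] := orbit_partition actP.
rewrite -defS big_trivIset // rpred_sum // => _ /imsetP[x Sx ->].
have sO : {in orbit to P x, forall y, s y = s x}.
  by move=> _ /orbitP[a Pa <-]; apply: invs.
rewrite (eq_bigr _ sO) sumr_const -mulr_natr.
have [fixx | /forall_inPn[a Pa nfix]] := boolP [forall (a | a \in P), to x a == x].
  rewrite fix0 ?mul0r ?rpred0 // => a Pa.
  by have /eqP := forall_inP fixx a Pa.
have dvO : (p %| #|orbit to P x|)%N.
  have [k Dk]: exists k, #|orbit to P x| = (p ^ k)%N.
    have: (#|orbit to P x| %| #|P|)%N by rewrite card_orbit dvdn_indexg.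
    move=> /pnat_dvd/(_ pP)/p_natP[] k Dk; by exists k.
  rewrite Dk; case: k Dk => [Dk|k _]; last by rewrite dvdn_exp.
  case/negP: nfix; have /card1P[y Dy]: #|orbit to P x| == 1%N by rewrite Dk.
  have:= orbit_refl to P x; have: to x a \in orbit to P x by apply: mem_orbit.
  by rewrite !Dy !inE => /eqP-> /eqP->.
have [q ->] := dvdnP dvO; rewrite natrM mulrA -eqAmod0 eqAmodMl0 //.
by rewrite rpredM ?intS ?Aint_Cnat ?rpred_nat.
Qed.

Section CosetNorm.

Variable gT : finGroupType.
Implicit Types (N D G : {group gT}).

(** For irreducible [chi] and linear [lam] the right side is 1 or 0 according to whether lam chi =
    chi. *)
Lemma cfdot_norm_lin G (chi lam : 'CF(G)) :
  '[chi * (chi^*)%CF, lam] = '[chi, lam * chi].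
Proof.
rewrite !cfdotE; congr (_ * _); apply: eq_bigr => x _.
by rewrite !cfunE rmorphM -mulrA; congr (_ * _); rewrite mulrC.
Qed.

Lemma Aint_rcoset_norm N D (chi : 'CF(D)) x : N <| D -> abelian (D / N)%g ->
    chi \is a character -> x \in D ->
  (\sum_(y in N :* x) `|chi y| ^+ 2) / #|N|%:R \in Aint.
Proof.
move=> nsND abDN Nchi Dx.
rewrite (eq_bigr (chi * (chi^*)%CF)) => [|y _]; last by rewrite !cfunE normCK.
rewrite sum_rcoset_abelian // mulrC mulKf ?pnatr_eq0 -?lt0n //.
apply: rpred_sum => l _; rewrite rpredM ?Aint_irr // Aint_Cnat //.
by rewrite Cnat_cfdot_char_irr // rpredM ?cfConjC_char.
Qed.

Lemma rcoset_norm_irr N D (i : Iirr D) x : N <| D -> abelian (D / N)%g ->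
    x \in D ->
    (forall l : Iirr (D / N), 'chi_(mod_Iirr l) * 'chi_i = 'chi_i -> l = 0) ->
  \sum_(y in N :* x) `|'chi_i y| ^+ 2 = #|N|%:R.
Proof.
move=> nsND abDN Dx stab1.
rewrite (eq_bigr ('chi_i * (('chi_i)^*)%CF)) => [|y _]; last by rewrite !cfunE normCK.
rewrite sum_rcoset_abelian // (bigD1 0) //= big1 ?addr0 => [|l nzl].
  rewrite cfdot_norm_lin mod_Iirr0 irr0 mul1r cfnorm_irr mul1r.
  by rewrite cfun1E Dx mulr1.
have Llam := mod_Iirr_linear l nsND abDN.
have /irrP[k Dk] : 'chi_(mod_Iirr l) * 'chi_i \in irr D.
  by rewrite mul_lin_irr ?mem_irr.
rewrite cfdot_norm_lin Dk cfdot_irr; case: eqP => [Dik | _]; last by rewrite mul0r.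
by rewrite (stab1 l) ?eqxx ?Dk ?Dik in nzl.
Qed.

End CosetNorm.

Lemma coset_expU (gT : finGroupType) n (M : {group gT}) x (v : {unit 'Z_n}) :
  x \in 'N(M) -> coset M (expU x v) = expU (coset M x) v.
Proof. by move=> NMx; rewrite /expU morphX. Qed.

Lemma dvdn_card_coset (gT : finGroupType) (M : {group gT}) :
  (#|[set: coset_of M]| %| #|[set: gT]|)%N.
Proof.
have ->: [set: coset_of M] = ('N(M) / M)%g.
  apply/setP=> y; rewrite inE; have [x NMx ->] := cosetP y.
  by rewrite mem_quotient.
by rewrite (dvdn_trans (dvdn_quotient _ _)) // cardSg // subsetT.
Qed.

Lemma quotient_cycle_elt (gT : finGroupType) (N D : {group gT}) x y :
    N <| D -> (D / N)%g = <[coset N x]> -> x \in D -> y \in D ->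
  exists2 k, (k < #|D : N|)%N & (y * (x ^+ k)^-1)%g \in N.
Proof.
move=> nsND defD Dx Dy; have nND := subsetP (normal_norm nsND).
have: coset N y \in (D / N)%g by rewrite mem_quotient.
rewrite defD => /cyclePmin[k ltk Dk]; exists k.
  by rewrite -card_quotient ?normal_norm // defD.
rewrite -mem_rcoset; apply/rcoset_kercosetP; rewrite ?groupX ?nND //.
by rewrite morphX ?nND.
Qed.

(** * Crossing a p'-factor below a cyclic p-quotient *)

Section CyclicPQuotient.

Variables (n : nat) (gT : finGroupType).
Hypotheses (n_gt1 : (1 < n)%N) (gTn : (#|[set: gT]| %| n)%N).
Variables (p : nat) (u : {unit 'Z_n}).
Hypotheses (pr_p : prime p) (p_u : p.-elt u).
Hypothesis (fix_p : forall x : gT, p.-elt x -> expU x u = x).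
Implicit Types (M N D E : {group gT}).

(** Modulo [N] the element [x] agrees with its p-part, on which the power map is the identity. *)
Lemma expU_pquotient N D x : N <| D -> p.-group (D / N)%g -> x \in D ->
  (x^-1 * expU x u)%g \in N.
Proof.
move=> nsND pDN Dx; have NNx := subsetP (normal_norm nsND) x Dx.
have NNxp : x.`_p%g \in 'N(N) by rewrite groupX.
have Dcx : coset N x = coset N x.`_p.
  have c1 : coset N x.`_p^'%g = 1%g.
    rewrite morph_constt //; apply/constt1P.
    by rewrite p_eltNK (mem_p_elt pDN) ?mem_quotient.
  by rewrite -[in LHS](consttC p x) morphM ?groupX //= c1 mulg1.
have Dcu : coset N (expU x u) = coset N x.
  by rewrite coset_expU // Dcx -coset_expU // fix_p ?p_elt_constt.
rewrite coset_idr ?groupM ?groupV ?groupX // morphM ?groupV ?groupX //=.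
by rewrite Dcu -morphM ?groupV // mulVg morph1.
Qed.

(** Outside the subgroup [D'] of index [p], [y] is x^k mod N with k prime to [p]; then lam(x) is
    killed by the coprime exponents k and |D : N|. *)
Lemma pquotient_lin_char N D D' (lam : 'CF(D)) x y :
    N <| D -> D' <| D -> N \subset D' -> prime #|D : D'| -> p.-group (D / N)%g ->
    (D / N)%g = <[coset N x]> -> x \in D -> y \in D -> y \notin D' ->
    lam \is a linear_char -> N \subset cfker lam ->
  lam y = 1 -> lam x = 1.
Proof.
move=> nsND nsD'D sND' prD' pDN defD Dx Dy nD'y Llam kerlam lam_y.
have [k ltk Nyk] := quotient_cycle_elt nsND defD Dx Dy.
have Dlam : lam y = lam x ^+ k.
  rewrite -lin_charX // -{1}(mulgKV (x ^+ k)%g y) lin_charM ?groupX //.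
    by rewrite (cfker1 (subsetP kerlam _ Nyk)) lin_char1 ?mul1r.
  by rewrite groupM ?groupV ?groupX.
have Dp : #|D : D'| = p.
  have: p.-nat #|D : D'|.
    by apply: pnat_dvd pDN; rewrite card_quotient ?normal_norm // indexgS.
  by rewrite pnatE // => /eqP.
have p'k : coprime p k.
  rewrite prime_coprime //; apply: contra nD'y => /dvdnP[m Dk].
  rewrite -(mulgKV (x ^+ k)%g y) groupM ?(subsetP sND' _ Nyk) //.
  rewrite Dk mulnC expgM groupX //; have D'x := subsetP (normal_norm nsD'D) x Dx.
  rewrite coset_idr ?groupX // morphX //=; apply/eqP.
  by rewrite -order_dvdn -Dp -card_quotient ?normal_norm // order_dvdG ?mem_quotient.
have co : coprime #|D : N| k.
  have /p_natP[e ->] : p.-nat #|D : N| by rewrite -card_quotient ?normal_norm.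
  exact: coprimeXl.
have lamq := lin_char_expg_index nsND Llam kerlam Dx.
have [a b Dab _]:= egcdnP k (indexg_gt0 D N).
rewrite Dlam in lam_y; have:= congr1 (fun m => lam x ^+ m) Dab.
rewrite (eqP co) exprD expr1 mulnC exprM lamq expr1n mulnC exprM lam_y expr1n.
by rewrite mul1r => /esym.
Qed.

End CyclicPQuotient.

Section PrimeToPFactor.

Variables (n : nat) (gT : finGroupType).
Hypotheses (n_gt1 : (1 < n)%N) (gTn : (#|[set: gT]| %| n)%N).
Variables (p : nat) (u : {unit 'Z_n}).
Hypotheses (pr_p : prime p) (p_u : p.-elt u).
Hypothesis (fix_p : forall x : gT, p.-elt x -> expU x u = x).
Implicit Types (M N D E : {group gT}).

Lemma lin_char_generator_eq1 N D (lam : 'CF(D)) x : N <| D ->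
    (D / N)%g = <[coset N x]> -> x \in D -> lam \is a linear_char ->
    N \subset cfker lam -> lam x = 1 -> lam = 1.
Proof.
move=> nsND defD Dx Llam kerlam lamx; apply/cfun_inP => y Dy.
have [k _ Nyk] := quotient_cycle_elt nsND defD Dx Dy.
rewrite cfun1E Dy -{1}(mulgKV (x ^+ k)%g y) lin_charM ?groupX //.
  by rewrite (cfker1 (subsetP kerlam _ Nyk)) lin_char1 // lin_charX // lamx expr1n mul1r.
by rewrite groupM ?groupV ?groupX.
Qed.

Lemma sum_rcoset_cosets M N D x (f : gT -> algC) : M <| D -> N <| D -> M \subset N ->
    x \in D ->
  \sum_(y in N :* x) f y = \sum_(Y in (N / M)%g :* coset M x) \sum_(y in (Y : {set gT})) f y.
Proof.
move=> nsMD nsND sMN Dx; have NMD := subsetP (normal_norm nsMD).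
have sND := subsetP (normal_sub nsND).
rewrite (partition_big (coset M) (mem ((N / M)%g :* coset M x))) /=; last first.
  move=> _ /rcosetP[z Nz ->]; rewrite morphM ?(NMD _ Dx) ?(NMD _ (sND _ Nz)) //.
  by rewrite mem_rcoset mulgK mem_quotient.
apply: eq_bigr => Y /rcosetP[_ /morphimP[z NMz Nz ->] ->]; apply: eq_bigl => y.
have NMzx : (z * x)%g \in 'N(M) by rewrite groupM ?(NMD _ Dx).
rewrite -morphM ?(NMD _ Dx) //= val_coset //.
apply/andP/idP=> [[/rcosetP[w Nw ->] /eqP/rcoset_kercosetP]|].
  by apply; rewrite // groupM ?(NMD _ Dx) ?(NMD _ (sND _ Nw)).
move=> yMzx; have: y \in N :* x.
  move: yMzx; rewrite !mem_rcoset => /(subsetP sMN); rewrite invMg mulgA.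
  by rewrite groupMr ?groupV.
split=> //; apply/eqP/rcoset_kercosetP => //; have /rcosetP[w Nw ->] := yMzx.
by rewrite groupM // NMD ?(subsetP (normal_sub nsMD)).
Qed.

(* If chi^u = lam chi with lam(x) <> 1, then the normalized sums of |chi|^2 over
   the cosets of M in N x are algebraic integers, constant on u-orbits, and
   vanish at the u-fixed cosets, so their total is divisible by p.  But this
   total is |N / M|, because chi remains irreducible on D'. *)
Lemma fix_p'_factor M N D D' (j : Iirr D) x :
    M <| D -> N <| D -> D' <| D -> M \subset N -> N \subset D' ->
    prime #|D : D'| -> p^'.-group (N / M)%g -> p.-group (D / N)%g ->
    (D / N)%g = <[coset N x]> -> x \in D -> 'Res[D'] 'chi_j \in irr D' ->
    fixRes u 'chi_j D' ->
    (forall E : {group gT}, M \subset E -> E \subset D -> p.-group (E / M)%g ->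
       fixRes u 'chi_j E) ->
  cfAut (gal u) 'chi_j = 'chi_j.
Proof.
move=> nsMD nsND nsD'D sMN sND' prD' p'NM pDN defD Dx irrD' fixD' fixE.
have abDN : abelian (D / N)%g by rewrite defD cycle_abelian.
have NMD := subsetP (normal_norm nsMD); have sND := subsetP (normal_sub nsND).
rewrite -aut_IirrE.
have [|l Dl] := @irr_ext_mul _ D D' j (aut_Iirr (gal u) j) nsD'D irrD'.
  by rewrite aut_IirrE -cfAutRes fixRes_cfAut ?irr_char.
rewrite Dl; rewrite aut_IirrE in Dl; set lam := 'chi_(mod_Iirr l) in Dl *.
have Llam : lam \is a linear_char.
  apply: mod_Iirr_linear => //.
  by rewrite cyclic_abelian ?prime_cyclic ?card_quotient ?normal_norm.
have kerlam : N \subset cfker lam.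
  exact: subset_trans sND' (mod_Iirr_ker l nsD'D).
(* If lam(x) = 1 then lam = 1, as [x] generates D / N; the other case is refuted below. *)
have [lamx | lamx] := eqVneq (lam x) 1.
  by rewrite (lin_char_generator_eq1 nsND defD Dx Llam kerlam lamx) mul1r.
have notD'x : x \notin D'.
  apply: contra lamx => D'x; rewrite (cfker1 (subsetP (mod_Iirr_ker l nsD'D) x D'x)).
  by rewrite lin_char1.
have nzD' (mu : 'CF(D)) y : mu \is a linear_char -> N \subset cfker mu ->
    mu x != 1 -> y \in D -> y \notin D' -> mu y != 1.
  move=> Lmu kermu mux Dy nD'y; apply: contra mux => /eqP muy; apply/eqP.
  exact: (pquotient_lin_char pr_p nsND nsD'D sND' prD' pDN defD Dx Dy nD'y Lmu).
have Nx_notD' y : y \in N :* x -> y \in D /\ y \notin D'.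
  case/rcosetP=> z Nz ->; split; first by rewrite groupM // sND.
  by rewrite groupMl // (subsetP sND').
have norm1 : \sum_(y in N :* x) `|'chi_j y| ^+ 2 = #|N|%:R.
  (* A nontrivial mu stabilizing chi differs from 1 off [D'], so chi vanishes there; its restriction
     to [D'] would then have norm |D : D'| and not be irreducible. *)
  apply: rcoset_norm_irr => // k stab_k; apply/eqP; apply: contraTT irrD' => nz_k.
  pose mu := 'chi_(mod_Iirr k).
  have Lmu : mu \is a linear_char by apply: mod_Iirr_linear.
  have kermu : N \subset cfker mu by apply: mod_Iirr_ker.
  have mux : mu x != 1.
    apply: contra nz_k => /eqP mux.
    have /eqP := lin_char_generator_eq1 nsND defD Dx Lmu kermu mux.
    by rewrite -irr0 (inj_eq irr_inj) mod_Iirr_eq0.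
  have onD' : 'chi_j \in 'CF(D, D').
    apply/cfun_onP => y nD'y; have [Dy | /cfun0->//] := boolP (y \in D).
    apply/eqP; apply: contraTT (nzD' mu y Lmu kermu mux Dy nD'y) => nz; rewrite negbK.
    apply/eqP; apply: (mulIf nz); rewrite mul1r -[in RHS]stab_k cfunE //.
  have [_ eqN] := cfnorm_Res_leif 'chi_j (normal_sub nsD'D).
  rewrite onD' cfnorm_irr mulr1 in eqN.
  apply/negP=> /irrP[t Dt]; move: eqN; rewrite Dt cfnorm_irr.
  by rewrite eq_sym -[1]/(1%:R) eqr_nat => /eqP i1; rewrite i1 in prD'.
pose s (Y : coset_of M) := (\sum_(y in (Y : {set gT})) `|'chi_j y| ^+ 2) / #|M|%:R.
have Mn : (#|[set: coset_of M]| %| n)%N by apply: dvdn_trans gTn; apply: dvdn_card_coset.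
pose to := expU_action n_gt1 Mn.
pose S := (N / M)%g :* coset M x.
have SP Y : Y \in S -> exists2 y, y \in N :* x & Y = coset M y.
  case/rcosetP=> _ /morphimP[z NMz Nz ->] ->; exists (z * x)%g.
    by rewrite mem_rcoset mulgK.
  by rewrite morphM ?(NMD _ Dx).
have coset_s y : y \in D -> s (coset M y) = (\sum_(z in M :* y) `|'chi_j z| ^+ 2) / #|M|%:R.
  by move=> Dy; congr (_ / _); apply: eq_bigl => z; rewrite val_coset ?NMD.
have dvS : (p %| \sum_(Y in S) s Y)%A.
  have to_coset y v : y \in D -> to (coset M y) v = coset M (expU y v).
    by move=> Dy; rewrite /= coset_expU ?NMD.
  have toS Y : Y \in S -> to Y u \in S.
    case/SP=> y Nxy ->; have [Dy _] := Nx_notD' y Nxy.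
    have Nyu := expU_pquotient fix_p nsND pDN Dy.
    have Nxyu : expU y u \in N :* x.
      have NNx : (N :* x = x *: N)%g by rewrite norm_rlcoset ?(subsetP (normal_norm nsND)).
      rewrite -(mulKVg y (expU y u)) NNx mem_lcoset mulgA groupMr //.
      by rewrite -mem_lcoset -NNx.
    have [z Nz Dz] := rcosetP Nxyu.
    rewrite to_coset // Dz morphM ?(NMD _ Dx) ?(NMD _ (sND _ Nz)) //.
    by rewrite mem_rcoset mulgK mem_quotient.
  have inv_u Y : Y \in S -> s (to Y u) = s Y.
    case/SP=> y Nxy ->; have [Dy _] := Nx_notD' y Nxy.
    rewrite to_coset // !coset_s ?groupX //; congr (_ / _).
    rewrite (reindex_inj (act_inj (expU_action n_gt1 gTn) u)) /=.
    (* Elements outside the normalizer of [M] are treated apart, since [coset M] takes its default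
       value there. *)
    have memMy z : (expU z u \in M :* expU y u) = (z \in M :* y).
      have [NMz | nNMz] := boolP (z \in 'N(M)).
        rewrite [LHS](sameP (rcoset_kercosetP _ _) eqP) ?groupX // ?NMD //.
        rewrite [RHS](sameP (rcoset_kercosetP _ _) eqP) // ?NMD //.
        rewrite !coset_expU // ?NMD //; by apply/idP/idP=> /eqP; [move/(act_inj to u)->|move->].
      have NMy : M :* y \subset 'N(M) by rewrite mul_subG ?normG ?sub1set ?NMD.
      have NMyu : M :* expU y u \subset 'N(M).
        by rewrite mul_subG ?normG // sub1set groupX ?NMD.
      apply/idP/idP=> [/(subsetP NMyu) | /(subsetP NMy)]; last by rewrite (negPf nNMz).
      move=> NMzu; case/negP: nNMz.
      have ->: z = expU (expU z u) u^-1 by rewrite -(expUM n_gt1 gTn) mulgV /expU expg1.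
      exact: groupX.
    apply: eq_big => // z; rewrite memMy => Myz.
    have Dz : z \in D.
      by have [w Mw ->] := rcosetP Myz; rewrite groupM // (subsetP (normal_sub nsMD)).
    (* |lam| = 1 on [D], hence |chi^u| = |chi|. *)
    rewrite -(cfAut_galE n_gt1 gTn) ?irr_char // Dl cfunE normrM.
    by rewrite (normC_lin_char Llam Dz) mul1r.
  apply: (@dvdA_sum_pgroup_orbits _ <[u]>%G _ to) => //.
  - rewrite cycle_subG inE in_setT inE; apply/subsetP=> Y SY.
    by rewrite inE toS.
  - move=> Y _ SY /cycleP[k ->].
    suff [] : to Y (u ^+ k)%g \in S /\ s (to Y (u ^+ k)%g) = s Y by [].
    elim: k => [|k [Sk IHk]]; first by rewrite expg0 act1.
    by rewrite expgSr actM inv_u // toS.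
  - move=> _ /SP[y Nxy ->]; have [Dy _] := Nx_notD' y Nxy; rewrite coset_s //.
    have sED : M <*> <[y]> \subset D by rewrite join_subG normal_sub // cycle_subG.
    have Ey : y \in M <*> <[y]> by rewrite (subsetP (joing_subr _ _)) ?cycle_id.
    have nsME : M <| M <*> <[y]> := normalS (joing_subl _ _) sED nsMD.
    have abE : abelian ((M <*> <[y]>) / M)%g.
      by rewrite quotientYidl ?cycle_subG ?NMD // quotient_abelian ?cycle_abelian.
    rewrite (eq_bigr (fun z => `|'Res[M <*> <[y]>] 'chi_j z| ^+ 2)) => [|z Myz].
      by apply: (Aint_rcoset_norm nsME abE) Ey; rewrite cfRes_char ?irr_char.
    have [w Mw ->] := rcosetP Myz; rewrite cfResE // groupM //.
    exact: (subsetP (joing_subl _ _)).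
  (* For [z] in a coset fixed by [u]: the constituents on M<z_p> are fixed by [fixE], and then those
     on M<z>, a p'-extension on which [u] acts trivially mod M. So chi(z) = lam(z) chi(z) with
     lam(z) <> 1, and chi(z) = 0. *)
  move=> _ /SP[y Nxy ->] fix_y; have [Dy _] := Nx_notD' y Nxy; rewrite coset_s //.
  rewrite big1 ?mul0r // => z Myz.
  have Nxz : z \in N :* x.
    have [w Mw ->] := rcosetP Myz; have [v Nv ->] := rcosetP Nxy.
    by rewrite mulgA mem_rcoset mulgK groupM // (subsetP sMN).
  have [Dz nD'z] := Nx_notD' z Nxz; have NMz := NMD z Dz.
  have Dcz : coset M z = coset M y.
    by apply/rcoset_kercosetP; rewrite ?NMD.
  have fix_z : expU (coset M z) u = coset M z by rewrite Dcz -{2}(fix_y u) ?cycle_id.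
  pose E := (M <*> <[z]>)%G; pose Ep := (M <*> <[z.`_p]>)%G.
  have sED : E \subset D by rewrite join_subG normal_sub // cycle_subG.
  have NMzp : z.`_p%g \in 'N(M) by rewrite groupX.
  have Ez : z \in E by rewrite (subsetP (joing_subr _ _)) ?cycle_id.
  have Epzp : z.`_p%g \in Ep by rewrite (subsetP (joing_subr _ _)) ?cycle_id.
  have sEpE : Ep \subset E by rewrite join_subG joing_subl cycle_subG groupX.
  have nsME : M <| E := normalS (joing_subl _ _) sED nsMD.
  have defE : (E / M)%g = <[coset M z]>.
    by rewrite /= quotientYidl ?cycle_subG // quotient_cycle.
  have abE : abelian (E / M)%g by rewrite defE cycle_abelian.
  have nsEpE : Ep <| E.
    rewrite sub_der1_normal // (subset_trans _ (joing_subl _ _)) //.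
    by rewrite der1_min ?normal_norm.
  have fixEp : fixRes u 'chi_j Ep.
    apply: fixE; rewrite ?joing_subl ?(subset_trans sEpE) //.
    rewrite /= quotientYidl ?cycle_subG // quotient_cycle //.
    by rewrite -[p.-group _]/(p.-elt _) morph_p_elt // p_elt_constt.
  have p'E : p^'.-group (E / Ep)%g.
    have ->: E = (Ep <*> <[z]>)%G.
      have sMEp : M \subset Ep := joing_subl _ _.
      apply: group_inj; apply/eqP; rewrite eqEsubset; apply/andP; split.
        by rewrite join_subG joing_subr (subset_trans sMEp) ?joing_subl.
      by rewrite join_subG sEpE cycle_subG.
    have NEpz : z \in 'N(Ep) by rewrite (subsetP (normal_norm nsEpE)).
    rewrite /= quotientYidl ?cycle_subG // quotient_cycle //.
    have : coset Ep (z.`_p * z.`_p^')%g = coset Ep z.`_p^'%g.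
      by rewrite morphM ?groupX //= coset_id // mul1g.
    rewrite consttC => ->.
    by rewrite -[_.-group _]/(p^'.-elt _) morph_p_elt ?groupX // p_elt_constt.
  have fixEE : fixRes u 'chi_j E.
    apply: (fixRes_p' n_gt1 gTn p_u (irr_char j) sED nsEpE p'E _ fixEp) => w Ew.
    have NMw : w \in 'N(M) by rewrite NMD ?(subsetP sED).
    apply: (subsetP (joing_subl _ _)).
    rewrite coset_idr ?groupM ?groupV ?groupX // morphM ?groupV ?groupX //=.
    suff ->: coset M (expU w u) = coset M w by rewrite -morphM ?groupV // mulVg morph1.
    have: coset M w \in (E / M)%g by rewrite mem_quotient.
    rewrite coset_expU // defE => /cycleP[k ->].
    by rewrite /expU -!expgM mulnC expgM -/(expU _ u) fix_z.
  have:= fixRes_cfAut (irr_char j) fixEE.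
  move/(congr1 (fun f : 'CF(E) => f z)); rewrite cfAutRes !cfResE // Dl cfunE.
  have := nzD' lam z Llam kerlam lamx Dz nD'z; have [->|nz] := eqVneq ('chi_j z) 0.
    by rewrite normr0 expr0n.
  by move=> neq1 /(canRL (mulfK nz)); rewrite mulfV // => /eqP; rewrite (negPf neq1).
have sumS : \sum_(Y in S) s Y = #|(N / M)%g|%:R.
  rewrite -mulr_suml -(sum_rcoset_cosets _ nsMD nsND sMN Dx) norm1 card_quotient; last first.
    by apply/subsetP=> y Ny; rewrite NMD ?sND.
  by rewrite -(Lagrange sMN) natrM mulrC mulKf ?pnatr_eq0 -?lt0n.
rewrite sumS -eqAmod0 eqAmod0_nat in dvS.
by have:= p'NM; rewrite /pgroup p'natE // dvS.
Qed.

End PrimeToPFactor.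

(** * Descent along a normal series *)

Section NormalSeries.

Variables (n : nat) (gT : finGroupType).
Hypotheses (n_gt1 : (1 < n)%N) (gTn : (#|[set: gT]| %| n)%N).
Variables (p : nat) (u : {unit 'Z_n}).
Hypotheses (pr_p : prime p) (p_u : p.-elt u).
Hypothesis (fix_p : forall x : gT, p.-elt x -> expU x u = x).
Implicit Types (M N D E : {group gT}).

Variables (G : {group gT}) (i : Iirr G).

(** Required of all normal [N], as in [qprim] below, this is quasi-primitivity of chi_i. *)
Definition homogeneous_res N := {in irr_constt ('Res[N] 'chi_i) &, forall j k, j = k}.

Hypothesis qprim : forall N, N <| G -> homogeneous_res N.

(** A constituent on [M] and its Galois conjugate both lie below the same fixed constituent on [N];
    homogeneity on [M] identifies them. *)
Lemma homogeneous_fixRes M N : M <| G -> M \subset N -> N \subset G ->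
  fixRes u 'chi_i N -> fixRes u 'chi_i M.
Proof.
move=> nsMG sMN sNG fixN j jR.
have [k kR jk] := constt_Res_Res sMN sNG (irr_char i) jR.
have uj : aut_Iirr (gal u) j \in irr_constt ('Res[M] 'chi_i).
  rewrite -(cfResRes _ sMN sNG); apply: (constt_Res_trans _ kR).
    by rewrite cfRes_char ?irr_char.
  rewrite irr_consttE aut_IirrE -(fixN k kR) -cfAutRes cfdot_aut_irr fmorph_eq0.
  by rewrite -irr_consttE.
by rewrite -aut_IirrE (qprim nsMG uj jR).
Qed.

(** Locality reduces to cyclic D / N, climbed in steps of prime index. A constituent induced from
    the lower group is fixed along with it; otherwise it restricts irreducibly and [fix_p'_factor]
    applies. *)
Lemma fixRes_p'_factor M N D : M <| G -> N <| G -> M \subset N ->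
    p^'.-group (N / M)%g -> fixRes u 'chi_i N ->
    (forall E : {group gT}, M \subset E -> E \subset G -> p.-group (E / M)%g ->
       fixRes u 'chi_i E) ->
    N \subset D -> D \subset G -> p.-group (D / N)%g ->
  fixRes u 'chi_i D.
Proof.
move=> nsMG nsNG sMN p'NM fixN fixE.
have [[sNG nNG] [sMG nMG]] := (andP nsNG, andP nsMG).
suff cyc E : N \subset E -> E \subset G -> cyclic (E / N)%g -> p.-group (E / N)%g ->
    fixRes u 'chi_i E.
  move=> sND sDG pDN; apply: (fixRes_local (irr_char i) sDG) => x Dx.
  have NNx := subsetP (subset_trans sDG nNG) x Dx.
  have sED : N <*> <[x]> \subset D by rewrite join_subG sND cycle_subG.
  exists (N <*> <[x]>)%G; split=> //; first by rewrite (subsetP (joing_subr _ _)) ?cycle_id.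
  apply: cyc; rewrite ?joing_subl ?(subset_trans sED) //.
    by rewrite /= quotientYidl ?cycle_subG // quotient_cyclic ?cycle_cyclic.
  exact: pgroupS (quotientS _ sED) pDN.
move=> {D}; have [m] := ubnP #|E|; elim: m E => // m IHm D /ltnSE-leDm sND sDG cycDN pDN.
have nsND : N <| D := normalS sND sDG nsNG.
have nsMD : M <| D := normalS (subset_trans sMN sND) sDG nsMG.
have [DN1 | ntDN] := eqVneq (D / N)%g 1%g.
  suff ->: D = N by [].
  apply: group_inj; apply/eqP; rewrite eqEsubset sND andbT.
  by rewrite -(quotient_sub1 (normal_norm nsND)) DN1 subxx.
have solDN : solvable (D / N)%g by rewrite abelian_sol ?cyclic_abelian.
have [D' [nsND' nsD'D prDD' _]] := prime_index_sol nsND solDN ntDN.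
have sD'D := normal_sub nsD'D.
have fixD' : fixRes u 'chi_i D'.
  apply: IHm (normal_sub nsND') _ _ _.
  - apply: leq_trans leDm; rewrite proper_card // properE sD'D -indexg_gt1.
    exact: prime_gt1.
  - exact: subset_trans sDG.
  - exact: cyclicS (quotientS _ sD'D) cycDN.
  exact: pgroupS (quotientS _ sD'D) pDN.
have /cyclicP[Y defY] := cycDN.
have: Y \in (D / N)%g by rewrite defY cycle_id.
case/morphimP=> x NNx Dx defYx; rewrite {}defYx in defY.
move=> j jR; have fixjD' := fixRes_Res sD'D sDG (irr_char i) jR fixD'.
have [irrD' | IndD'] := Res_prime_irr_or_Ind j nsD'D prDD'; last first.
  have [k kR] := constt_cfRes_irr D' j.
  by rewrite -(IndD' k kR) cfAutInd fixjD'.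
apply: (fix_p'_factor n_gt1 gTn pr_p p_u fix_p nsMD nsND nsD'D sMN) defY Dx irrD' fixjD' _ => //.
  exact: normal_sub.
move=> E sME sED pEM; apply: (fixRes_Res sED sDG (irr_char i) jR).
by apply: fixE; rewrite // (subset_trans sED).
Qed.

(** Induction on the series, for all [D] at once: if N / M is a p-group then so is D / M; if it is a
    p'-group, the case of [M] supplies the p-extensions [E] of [M] to [fixRes_p'_factor]. At N = 1
    the power map is trivial on the p-group [D]. *)
Lemma fixRes_normal_pser N D : normal_pser p G N -> N \subset D -> D \subset G ->
  p.-group (D / N)%g -> fixRes u 'chi_i N -> fixRes u 'chi_i D.
Proof.
move=> serN; elim: serN D => [|M {}N serM IHM sMN nsNG p_or_p'] D sND sDG pDN fixN.
  move=> j _; apply/cfun_inP => x Dx; rewrite (cfAut_galE n_gt1 gTn) ?irr_char //.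
  rewrite fix_p //; apply: mem_p_elt Dx.
  by rewrite (isog_pgroup p (quotient1_isog D)).
have nsMG := normal_pser_normal serM.
have fixM : fixRes u 'chi_i M.
  exact: homogeneous_fixRes nsMG sMN (normal_sub nsNG) fixN.
have sMD := subset_trans sMN sND.
case/orP: p_or_p' => [pNM | p'NM].
  apply: IHM => //; rewrite /pgroup card_quotient; last first.
    by rewrite (subset_trans sDG) ?normal_norm.
  rewrite -(Lagrange_index sND sMN) pnatM -!card_quotient.
  - by rewrite -/(pgroup _ _) pDN.
  - by rewrite (subset_trans (normal_sub nsNG)) ?normal_norm.
  by rewrite (subset_trans sDG) ?normal_norm.
apply: fixRes_p'_factor nsMG nsNG sMN p'NM fixN _ sND sDG pDN => E sME sEG pEM.
exact: IHM.
Qed.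

End NormalSeries.

(** * Divisibility of the degree *)

Lemma cfDetAut (gT : finGroupType) (G : {group gT}) (f : {rmorphism algC -> algC})
    (chi : 'CF(G)) : chi \is a character -> cfDet (cfAut f chi) = cfAut f (cfDet chi).
Proof.
case/char_reprP=> rG ->; rewrite -cfRepr_map !cfDetRepr.
apply/cfun_inP=> x Gx; rewrite !cfunE !trace_mx11 !mxE Gx !mulr1n.
by rewrite /= det_map_mx.
Qed.

(** * Stabilizers and the Clifford correspondence *)

Section Stabilizers.

Variables (n : nat) (gT : finGroupType).
Hypotheses (n_gt1 : (1 < n)%N) (gTn : (#|[set: gT]| %| n)%N).
Implicit Types (v w : {unit 'Z_n}) (G N T : {group gT}).

Definition stabU G (i : Iirr G) : {set {unit 'Z_n}} :=
  [set v | cfAut (gal v) 'chi_i == 'chi_i].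

Lemma stabUP G (i : Iirr G) v : reflect (cfAut (gal v) 'chi_i = 'chi_i) (v \in stabU i).
Proof. by rewrite inE; apply: eqP. Qed.

Lemma stabU_group_set G (i : Iirr G) : group_set (stabU i).
Proof.
apply/group_setP; split=> [|v w]; first by rewrite inE cfAut_gal1 ?irr_char.
by move=> /stabUP v1 /stabUP w1; rewrite inE (cfAut_galM n_gt1 gTn) ?irr_char // w1 v1.
Qed.

Canonical stabU_group G (i : Iirr G) := Group (stabU_group_set i).

Definition galIirr_action G := Action (galIirr_is_action n_gt1 gTn G).

Lemma stabU_astab1 G (i : Iirr G) (A : {group {unit 'Z_n}}) :
  'C_A[i | galIirr_action G] = A :&: stabU i.
Proof.
apply/setP=> v; rewrite !inE sub1set inE; congr (_ && _).
by rewrite -(inj_eq irr_inj) /= /galIirr aut_IirrE.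
Qed.

Lemma aut_constt_Res G N (i : Iirr G) t v : cfAut (gal v) 'chi_i = 'chi_i ->
    t \in irr_constt ('Res[N] 'chi_i) ->
  aut_Iirr (gal v) t \in irr_constt ('Res[N] 'chi_i).
Proof.
move=> vi tR; rewrite irr_consttE aut_IirrE -vi -cfAutRes cfdot_aut_irr fmorph_eq0.
by rewrite -irr_consttE.
Qed.

Lemma stabU_homogeneous G N (i : Iirr G) t : homogeneous_res i N ->
  t \in irr_constt ('Res[N] 'chi_i) -> stabU i \subset stabU t.
Proof.
move=> hom tR; apply/subsetP=> v /stabUP vi; apply/stabUP.
by rewrite -aut_IirrE; congr 'chi_ _; apply: hom; rewrite ?aut_constt_Res.
Qed.

Lemma index_stabU_constt G N (i : Iirr G) t (A : {group {unit 'Z_n}}) :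
    N <| G -> t \in irr_constt ('Res[N] 'chi_i) -> A \subset stabU i ->
  (#|A : A :&: stabU t| %| #|G : 'I_G['chi_t]|)%N.
Proof.
move=> nsNG tR sAi; rewrite -card_cfclass_Iirr //.
have actA : [acts A, on cfclass_Iirr G t | galIirr_action N].
  apply/subsetP=> v Av; rewrite inE in_setT inE; apply/subsetP=> _ /imsetP[y Gy ->].
  rewrite inE /= /galIirr; have /stabUP vi := subsetP sAi v Av.
  have [z Gz Dz] := constt_Res_conjg nsNG tR (aut_constt_Res vi tR).
  apply/imsetP; exists (z * y)%g; first exact: groupM.
  apply: irr_inj; rewrite aut_IirrE !conjg_IirrE cfAutConjg -aut_IirrE Dz.
  by rewrite (cfConjgM _ nsNG).
rewrite -(acts_sum_card_orbit actA); apply: dvdn_sum => _ /imsetP[_ /imsetP[y Gy ->] ->].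
(* Galois automorphisms commute with conjugation by [y], so all conjugates of [t] have the same
   stabilizer. *)
rewrite card_orbit stabU_astab1; suff ->: stabU (conjg_Iirr t y) = stabU t by [].
apply/setP=> v; rewrite !inE conjg_IirrE cfAutConjg.
rewrite -conjg_IirrE -aut_IirrE -!conjg_IirrE (inj_eq irr_inj).
by rewrite (inj_eq (conjg_Iirr_inj _)) -(inj_eq irr_inj) aut_IirrE.
Qed.

(** Induction commutes with Galois automorphisms; conversely a unit fixing chi_i and chi_t fixes
    chi_s by uniqueness of the Clifford correspondent. *)
Lemma Clifford_stabU G N (i : Iirr G) t (T := 'I_G['chi_t]%G) :
    N <| G -> t \in irr_constt ('Res[N] 'chi_i) ->
  exists s : Iirr T, [/\ 'Ind[G] 'chi_s = 'chi_i, stabU s \subset stabU i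
    & stabU i :&: stabU t \subset stabU s].
Proof.
move=> nsNG tR; have [irrInd injInd imInd _ _] := constt_Inertia_bijection t nsNG.
have: i \in irr_constt ('Ind[G] 'chi_t) by rewrite constt_Ind_Res.
rewrite -imInd => /imsetP[s sI Di].
have Dchi : 'Ind[G] 'chi_s = 'chi_i by rewrite Di cfIirrE ?irrInd.
exists s; split=> //; apply/subsetP=> v.
  by move/stabUP=> vs; apply/stabUP; rewrite -Dchi cfAutInd vs.
case/setIP=> /stabUP vi /stabUP vt; apply/stabUP; rewrite -aut_IirrE.
congr 'chi_ _; apply: injInd => //.
  rewrite irr_consttE aut_IirrE.
  have <- : cfAut (gal v) ('Ind[T] 'chi_t) = 'Ind[T] 'chi_t by rewrite cfAutInd vt.
  rewrite cfdot_aut_irr fmorph_eq0.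
  by rewrite -irr_consttE.
by rewrite -Di; apply: irr_inj; rewrite cfIirrE aut_IirrE -cfAutInd Dchi vi ?mem_irr.
Qed.

End Stabilizers.

Lemma dvdC_natE (a d : nat) : (a%:R %| (d%:R : algC))%C = (a %| d)%N.
Proof. exact: dvdC_nat. Qed.

Lemma dvd1_irr1 (gT : finGroupType) (G : {group gT}) (i : Iirr G) :
  (1%:R %| 'chi_i 1%g)%C.
Proof. by rewrite -(truncnK (Cnat_irr1 i)) dvdC_natE. Qed.

Section ModFour.

Variable n : nat.
Hypothesis n_gt1 : (1 < n)%N.
Implicit Types v w : {unit 'Z_n}.

Lemma unit_odd v : (2 %| n)%N -> odd (unat v).
Proof.
move=> n2; rewrite -[odd _]negbK -dvdn2 -prime_coprime // coprime_sym.
exact: coprime_dvdr n2 (coprime_unit n_gt1 v).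
Qed.

Lemma unit_ucong2 v : (2 %| n)%N -> v \in ucong n 2.
Proof. by move=> n2; rewrite inE modn2 unit_odd. Qed.

(* Units outside the subgroup are all 3 mod 4. *)
Lemma ucong4_div v w : (4 %| n)%N -> v \notin ucong n 4 -> w \notin ucong n 4 ->
  (v * w^-1)%g \in ucong n 4.
Proof.
move=> n4; have n2 : (2 %| n)%N by apply: dvdn_trans n4.
have mod3 x : x \notin ucong n 4 -> unat x = 3 %[mod 4].
  rewrite inE; have := unit_odd x n2; have := ltn_pmod (unat x) (isT : (0 < 4)%N).
  rewrite -(@odd_mod (unat x) 4) //.
  by case: (unat x %% 4)%N => [|[|[|[|]]]].
by move=> /mod3 v3 /mod3 w3; apply/(eqmod_ucong n_gt1 n4); rewrite v3 w3.
Qed.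

Lemma index_ucong4 (A : {group {unit 'Z_n}}) : (4 %| n)%N -> (#|A : ucong n 4| %| 2)%N.
Proof.
move=> n4; rewrite -[ucong n 4]/(gval (ucongG n_gt1 n4)); set S := ucongG _ _.
have [sAS | /subsetPn[v Av nSv]] := boolP (A \subset S).
  by have := indexg_eq1 A S; rewrite sAS => /eqP->.
have le2 : (#|A : S| <= 2)%N.
  apply: (@leq_trans #|[set gval S; S :* v]|); last by rewrite cards2; case: (_ != _).
  apply: subset_leq_card; apply/subsetP=> _ /rcosetsP[w Aw ->]; rewrite !inE.
  have [Sw | nSw] := boolP (w \in S); first by rewrite rcoset_id ?eqxx.
  by apply/orP; right; apply/eqP/rcoset_eqP; rewrite mem_rcoset; apply: ucong4_div.
by have := indexg_gt0 A S; case: #|_ : _| le2 => [|[|[|]]].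
Qed.

End ModFour.

(** * Quotients prime to p and quotients of order p *)

Section PrimeLevel.

Variables (n : nat) (gT : finGroupType).
Hypotheses (n_gt1 : (1 < n)%N) (gTn : (#|[set: gT]| %| n)%N).
Variables (p b m : nat).
Hypotheses (pr_p : prime p) (Dn : n = (p ^ b * m)%N) (co_pm : coprime p m).
Implicit Types (v w : {unit 'Z_n}) (G N T : {group gT}).

Lemma dvdn_pn s : (s <= b)%N -> (p ^ s %| n)%N.
Proof. by move=> le_sb; rewrite Dn dvdn_mulr ?dvdn_exp2l. Qed.

Lemma coprime_pXm : coprime (p ^ b) m. Proof. exact: coprimeXl. Qed.

Lemma dvdn_mn : (m %| n)%N. Proof. by rewrite Dn dvdn_mull. Qed.

Lemma expU_p_elt v (x : gT) : v \in ucong n (p ^ b) -> p.-elt x -> expU x v = x.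
Proof.
rewrite inE => /eqP v1 px; rewrite -[RHS]expg1 /expU; apply/eqP.
rewrite eq_expg_mod_order; have dvx : (#[x] %| p ^ b)%N.
  have [k Dk] := p_natP px; rewrite Dk.
  have := expgn1 gTn x => /eqP; rewrite -order_dvdn Dk Dn Gauss_dvdl //.
  by rewrite coprimeXl.
by rewrite -(modn_dvdm _ dvx) v1 modn_dvdm.
Qed.

Lemma expU_p'_elt (rT : finGroupType) v (x : rT) : v \in ucong n m -> p^'.-elt x ->
  (x ^+ n = 1)%g -> expU x v = x.
Proof.
rewrite inE => /eqP v1 px /eqP xn; rewrite -[RHS]expg1 /expU; apply/eqP.
rewrite eq_expg_mod_order; have dvx : (#[x] %| m)%N.
  move: xn; rewrite -order_dvdn Dn Gauss_dvdr // coprime_sym coprimeXl //.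
  by rewrite prime_coprime // -p'natE.
by rewrite -(modn_dvdm _ dvx) v1 modn_dvdm.
Qed.

(* A unit u is 1 mod p^(k-1) m exactly when it fixes Q_(p^(k-1) m); so the last
   hypothesis says that k does not exceed the p-exponent of the conductor.
   Quantifying over all A makes the bound pass to subgroups of the stabilizer. *)
Definition level_dvd (H : {group gT}) (j : Iirr H) := forall (A : {group {unit 'Z_n}}) k,
  (0 < k <= b)%N -> A \subset stabU n j :&: ucong n p ->
  k = 1%N \/ ~~ (ucong n (p ^ k.-1 * m) \subset stabU n j) ->
  (#|A : ucong n (p ^ k)|%:R %| 'chi_j 1%g)%C.

Section Homogeneous.

Variables (G : {group gT}) (i : Iirr G).
Hypothesis qprim : forall N, N <| G -> homogeneous_res i N.

Lemma ucong_stabU_p' N t k : N <| G -> p^'.-group (G / N)%g ->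
    t \in irr_constt ('Res[N] 'chi_i) -> (0 < k <= b)%N ->
  ucong n (p ^ k * m) \subset stabU n t -> ucong n (p ^ k * m) \subset stabU n i.
Proof.
move=> nsNG p'GN tR kb sFt; apply/subsetP=> v Fv.
have pv := ucong_pelt n_gt1 pr_p Dn co_pm kb Fv.
apply/stabUP/(fixRes_id v i).
apply: (fixRes_p' n_gt1 gTn pv (irr_char i) (subxx _) nsNG p'GN) => [x Gx | j jR].
  have NNx := subsetP (normal_norm nsNG) x Gx.
  rewrite coset_idr ?groupM ?groupV ?groupX // morphM ?groupV ?groupX //=.
  rewrite coset_expU // expU_p'_elt ?(mem_p_elt p'GN) ?mem_quotient //.
  - by rewrite -morphM ?groupV // mulVg morph1.
  - by apply: (subsetP (ucongS _ _)) Fv; rewrite dvdn_mull.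
  by rewrite -morphX // (expgn1 gTn) morph1.
by rewrite (qprim nsNG jR tR); apply/stabUP/(subsetP sFt).
Qed.

Section PrimeIndex.

Variables (N : {group gT}) (t : Iirr N).
Hypotheses (nsNG : N <| G) (indexN : #|G : N| = p) (serN : normal_pser p G N).
Hypothesis tR : t \in irr_constt ('Res[N] 'chi_i).

(** Were chi_i induced from chi_t, reciprocity would give multiplicity 1, and homogeneity excludes
    other constituents. *)
Lemma Res_prime_homogeneous : 'Res[N] 'chi_i = 'chi_t.
Proof.
have [|/irrP[k Dk]|IndN] := @Res_prime_irr_or_Ind _ G N i nsNG; first by rewrite indexN.
  by move: tR; rewrite Dk constt_irr inE => /eqP->.
rewrite ['Res[N] _]cfun_sum_constt (bigD1 t) //= big1 => [|j /andP[jR]]; last first.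
    by rewrite (qprim nsNG jR tR) eqxx.
  by rewrite addr0 cfdot_Res_l IndN // cfnorm_irr scale1r.
Qed.

Lemma stabU_twist v : v \in stabU n t -> exists l : Iirr (G / N),
  cfAut (gal v) 'chi_i = 'chi_(mod_Iirr l) * 'chi_i.
Proof.
move/stabUP=> vt; have Dres := Res_prime_homogeneous.
have [||l Dl] := @irr_ext_mul _ G N i (aut_Iirr (gal v) i) nsNG.
- by rewrite Dres mem_irr.
- by rewrite aut_IirrE -cfAutRes Dres.
by exists l; rewrite -Dl aut_IirrE.
Qed.

Lemma mod_Iirr_prime_linear (l : Iirr (G / N)) : 'chi_(mod_Iirr l) \is a linear_char.
Proof.
apply: mod_Iirr_linear => //.
by rewrite cyclic_abelian ?prime_cyclic ?card_quotient ?normal_norm // indexN.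
Qed.

Lemma mod_Iirr_expp (l : Iirr (G / N)) : 'chi_(mod_Iirr l) ^+ p = 1.
Proof.
apply/cfun_inP=> x Gx; rewrite exp_cfunE // cfun1E Gx -indexN.
apply: lin_char_expg_index nsNG _ _ Gx; first exact: mod_Iirr_prime_linear.
exact: mod_Iirr_ker.
Qed.

(** A unit that is 1 mod p fixes lam, so its p-th power twists chi_i by lam^p = 1. *)
Lemma stabU_expp v : v \in stabU n t -> v \in ucong n p -> (v ^+ p)%g \in stabU n i.
Proof.
move=> vt vp; have [l Dl] := stabU_twist vt; apply/stabUP.
rewrite (cfAut_gal_twistX n_gt1 gTn _ (irr_char i) Dl) ?mod_Iirr_expp ?mul1r //.
have Llam := mod_Iirr_prime_linear l; apply/cfun_inP=> x Gx.
rewrite (cfAut_galE n_gt1 gTn) ?lin_charW // /expU lin_charX //.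
move: vp; rewrite inE => /eqP v1.
have lamp : 'chi_(mod_Iirr l) x ^+ p = 1 by rewrite -exp_cfunE // mod_Iirr_expp cfun1E Gx.
by rewrite -(expr_mod _ lamp) v1 expr_mod.
Qed.

(** The p-part of [v] is handled by the normal series; its p'-part z is a power of z^p, which fixes
    chi_i. *)
Lemma stabU_p_component v : (0 < b)%N -> v \in stabU n t -> v \in ucong n p -> v \in ucong n (p ^ b) ->
  v \in stabU n i.
Proof.
move=> b_gt0 vt vp vb; have pn : (p %| n)%N by rewrite -[p]expn1 dvdn_pn.
have vpi : (v.`_p)%g \in stabU n i.
  have fp (x : gT) : p.-elt x -> expU x (v.`_p)%g = x.
    apply: expU_p_elt; rewrite -[ucong _ _]/(gval (ucongG n_gt1 (dvdn_pn (leqnn b)))).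
    exact: groupX.
  apply/stabUP/(fixRes_id _ i).
  apply: (fixRes_normal_pser n_gt1 gTn pr_p (p_elt_constt p v) fp qprim serN) => //.
  - exact: normal_sub.
  - by rewrite /pgroup card_quotient ?normal_norm // indexN pnat_id.
  move=> j jR; rewrite (qprim nsNG jR tR); apply/stabUP.
  by rewrite -[stabU _ _]/(gval (stabU_group n_gt1 gTn t)) groupX.
have vp'i : (v.`_p^')%g \in stabU n i.
  set z := (v.`_p^')%g; have: z \in <[z ^+ p]>.
    have /eqP <- : generator <[z]> (z ^+ p); last exact: cycle_id.
    by rewrite generator_coprime coprime_sym prime_coprime // -p'natE //; exact: p_elt_constt.
  have: (z ^+ p)%g \in stabU n i.
    rewrite -consttX -[stabU _ _]/(gval (stabU_group n_gt1 gTn i)) groupX //.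
    exact: stabU_expp.
  rewrite -[stabU _ _]/(gval (stabU_group n_gt1 gTn i)) -cycle_subG.
  by move/subsetP=> sz; apply: sz.
by rewrite -[v](consttC p) -[stabU _ _]/(gval (stabU_group n_gt1 gTn i)) groupM.
Qed.

(** [w] is [u] mod p^b made 1 mod m. Then u / w is 1 mod p^b and fixes chi_t, hence chi_i. What
    remains takes place among units that are 1 mod p^k m, a cyclic group except possibly for p = 2
    and k = 1. *)
Lemma stabU_split u k : (0 < k <= b)%N -> ucong n (p ^ k * m) \subset stabU n t ->
    u \in stabU n i -> u \in ucong n (p ^ k) ->
  exists w, [/\ w \in stabU n i, w \in ucong n (p ^ k * m)
             & unat u = unat w %[mod p ^ b]].
Proof.
move=> /andP[k_gt0 le_kb] sFt ui uk.
have [w [wm eq_uw uwb]] := ucong_factor n_gt1 u Dn coprime_pXm.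
have wk : w \in ucong n (p ^ k).
  move: uk; rewrite !inE -(modn_dvdm (unat w) (dvdn_exp2l p le_kb)) -eq_uw.
  by rewrite modn_dvdm // dvdn_exp2l.
have wkm : w \in ucong n (p ^ k * m) by apply: ucong_lcm; rewrite ?coprimeXl.
have pk : (p %| p ^ k)%N by rewrite dvdn_exp.
have ut : u \in stabU_group n_gt1 gTn t.
  exact: (subsetP (stabU_homogeneous n (qprim nsNG) tR)) ui.
have pn : (p %| n)%N by apply: dvdn_trans pk (dvdn_pn le_kb).
have wt : w \in stabU_group n_gt1 gTn t by apply: (subsetP sFt).
have ui' : u \in stabU_group n_gt1 gTn i by [].
have uwi : (u * w^-1)%g \in stabU_group n_gt1 gTn i.
  apply: stabU_p_component => //; first exact: leq_trans le_kb.
    by rewrite -[stabU _ _]/(gval (stabU_group n_gt1 gTn t)) groupM ?groupV.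
  apply: (subsetP (ucongS _ _)) uwb; rewrite dvdn_exp //.
  exact: leq_trans le_kb.
exists w; split=> //; rewrite -[stabU _ _]/(gval (stabU_group n_gt1 gTn i)).
by rewrite -groupV -(groupMl _ ui').
Qed.

Lemma stabU_gap u k j : (0 < k <= b)%N -> ~~ ((p == 2) && (k == 1%N)) -> (j <= b)%N ->
    ucong n (p ^ k * m) \subset stabU n t ->
    ~~ (ucong n (p ^ j.-1 * m) \subset stabU n i) ->
    u \in stabU n i -> u \in ucong n (p ^ k) ->
  u \in ucong n (p ^ j).
Proof.
move=> kb not21 le_jb sFt nsFi ui uk.
have [w [wi wkm eq_uw]] := stabU_split kb sFt ui uk; have /andP[k_gt0 _] := kb.
have := ucong_gap n_gt1 pr_p Dn co_pm (K := stabU_group n_gt1 gTn i) k_gt0 not21 le_jb wi wkm nsFi.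
rewrite !inE -(modn_dvdm (unat w) (dvdn_exp2l p le_jb)) -eq_uw.
by rewrite modn_dvdm // dvdn_exp2l.
Qed.

Section EvenPrime.

Hypotheses (p2 : p = 2%N) (b_gt1 : (1 < b)%N).
Hypothesis sF1 : ucong n (p * m) \subset stabU n t.
Hypothesis odd_t : ~~ (2%:R %| 'chi_t 1%g)%C.

(** A twist by lam multiplies the determinant by lam^chi(1), which is lam as chi(1) = chi_t(1) is
    odd and lam^2 = 1. *)
Lemma det_twist v : v \in stabU n t -> exists l : Iirr (G / N),
    cfAut (gal v) 'chi_i = 'chi_(mod_Iirr l) * 'chi_i
 /\ cfAut (gal v) (cfDet 'chi_i) = 'chi_(mod_Iirr l) * cfDet 'chi_i.
Proof.
move=> vt; have [l Dl] := stabU_twist vt; exists l; split=> //.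
rewrite -cfDetAut ?irr_char // Dl cfDet_mul_lin ?irr_char ?mod_Iirr_prime_linear //.
congr (_ * _); set a := Num.truncn _; have Da : 'chi_i 1%g = a%:R.
  by rewrite truncnK ?Cnat_irr1.
have odd_a : odd a.
  have Dt : 'chi_t 1%g = a%:R by rewrite -Da -Res_prime_homogeneous cfRes1.
  by move: odd_t; rewrite Dt dvdC_natE dvdn2 negbK.
have lam2 : 'chi_(mod_Iirr l) ^+ 2 = 1 by rewrite -p2 mod_Iirr_expp.
by rewrite -[a]odd_double_half odd_a exprS -mul2n exprM lam2 expr1n mulr1.
Qed.

(** Starting from -1, written [n.-1], one takes [w] equal to -1 mod 2^b and to 1 mod m. On a
    2-element delta^w is both delta^-1 and lam delta, so lam delta^2 = 1 and delta^4 = 1. *)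
Lemma det_expr4 x : x \in G -> p.-elt x -> cfDet 'chi_i x ^+ 4 = 1.
Proof.
move=> Gx px; have Ldet := cfDet_lin_char 'chi_i; set delta := cfDet _ in Ldet *.
have co : coprime n.-1 n by rewrite -[n in coprime _ n]prednK ?coprimenS // ltnW.
have [v0 Dv0] := exists_unit n_gt1 co.
have [w [wm Dw _]] := ucong_factor n_gt1 v0 Dn coprime_pXm.
have bn := dvdn_pn (leqnn b).
have dvw : (p ^ b %| (unat w).+1)%N.
  rewrite /dvdn -addn1 -modnDml -Dw -(modn_dvdm (unat v0) bn) Dv0.
  by rewrite modn_dvdm // modnDml addn1 prednK ?(ltnW n_gt1) //; apply: bn.
have w2 : w \in ucong n p.
  have : (2 %| (unat w).+1)%N by rewrite -p2 (dvdn_trans _ dvw) // dvdn_exp // ltnW.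
  by rewrite p2 inE dvdn2 /= negbK modn2 => ->.
have wt : w \in stabU n t by apply: (subsetP sF1); apply: ucong_lcm.
have [l [_ Ddet]] := det_twist wt.
have dvx : (#[x] %| p ^ b)%N.
  have [k Dk] := p_natP px; rewrite Dk.
  have := expgn1 gTn x => /eqP; rewrite -order_dvdn Dk Dn Gauss_dvdl //.
  by rewrite coprimeXl.
have dw : delta x ^+ (unat w).+1 = 1.
  rewrite -lin_charX //; have: (x ^+ (unat w).+1 == 1)%g.
    by rewrite -order_dvdn (dvdn_trans dvx).
  by move/eqP->; rewrite lin_char1.
have := congr1 (fun f : 'CF(G) => f x) Ddet; rewrite /= [X in _ = X -> _]cfunE.
rewrite (cfAut_galE n_gt1 gTn) ?lin_charW // /expU lin_charX // => Dx.
rewrite exprSr Dx -mulrA -expr2 in dw.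
have lam2 : 'chi_(mod_Iirr l) x ^+ 2 = 1.
  by rewrite -exp_cfunE // -{1}p2 mod_Iirr_expp cfun1E Gx.
by have := congr1 (fun z => z ^+ 2) dw; rewrite exprMn lam2 mul1r -exprM expr1n.
Qed.

(** A unit that is 1 mod 4m fixes the determinant: on 2-elements its values have order dividing 4,
    and 2'-elements are fixed by the power map. So the twist lam, visible on the determinant, is
    trivial. *)
Lemma ucong4_stabU : ucong n (p ^ 2 * m) \subset stabU n i.
Proof.
apply/subsetP=> v Fv; have Ldet := cfDet_lin_char 'chi_i.
have v1 : v \in ucong n (p * m).
  by apply: (subsetP (ucongS _ _)) Fv; rewrite dvdn_mul ?dvdn_exp.
have [l [Dl Ddet]] := det_twist (subsetP sF1 v v1).
apply/stabUP; rewrite Dl; suff ->: 'chi_(mod_Iirr l) = 1 by rewrite mul1r.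
have vm : v \in ucong n m by apply: (subsetP (ucongS _ _)) v1; rewrite dvdn_mull.
have v4 : unat v = 1 %[mod 4].
  apply/eqP; have: v \in ucong n 4; last by rewrite inE.
  by apply: (subsetP (ucongS _ _)) Fv; rewrite p2 dvdn_mulr.
apply/cfun_inP=> x Gx; have nz: cfDet 'chi_i x != 0 by rewrite lin_char_neq0.
apply: (mulIf nz); rewrite cfun1E Gx mul1r.
have := congr1 (fun f : 'CF(G) => f x) Ddet; rewrite /= [X in _ = X -> _]cfunE => <-.
rewrite (cfAut_galE n_gt1 gTn) ?lin_charW // /expU lin_charX //.
rewrite -[in RHS](consttC p x) -[in LHS](consttC p x) lin_charM ?groupX // exprMn.
congr (_ * _).
  have d4 := det_expr4 (groupX _ Gx : (x.`_p)%g \in G) (p_elt_constt p x).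
  by rewrite -(expr_mod _ d4) v4 expr_mod.
rewrite -lin_charX ?groupX // -/(expU _ v) expU_p'_elt ?p_elt_constt //.
exact: expgn1.
Qed.

(* (Z / 2^b)^* is not cyclic, but when chi(1) is odd the twist of chi by lam is
   visible on det chi, whose 2-part has order dividing 4. *)
Lemma odd_stabU_gap u j : (1 < j <= b)%N ->
    ~~ (ucong n (p ^ j.-1 * m) \subset stabU n i) ->
  u \in stabU n i -> u \in ucong n (p ^ j).
Proof.
move=> /andP[j_gt1 le_jb] nsFi ui; have p2m : ucong n (p ^ 2 * m) \subset stabU n i.
  exact: ucong4_stabU.
(* Units that are 1 mod 4m fix chi_i, so [nsFi] leaves only j = 2. *)
have j2 : j = 2%N.
  apply/eqP; rewrite eqn_leq j_gt1 andbT leqNgt; apply: contra nsFi => j_gt2.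
  apply: subset_trans p2m; apply: ucongS; rewrite dvdn_mul ?dvdn_exp2l //.
  by rewrite -ltnS prednK // ltnW.
have n4 : (4 %| n)%N by apply: dvdn_trans (dvdn_pn le_jb); rewrite j2 p2.
(* Let [f] be 1 mod 2m and not fix chi_i. If [u] is not 1 mod 4, then neither are [w] and [f]; so f
   / w is 1 mod 4m and fixes chi_i, and with [w] so does [f]. *)
rewrite {}j2 /= expn1 in nsFi *; have /subsetPn[f Ff nfi] := nsFi.
apply: contraR nfi => nu4; pose K := stabU_group n_gt1 gTn i.
have pn : (p %| n)%N by rewrite -[p]expn1 dvdn_pn // ltnW.
have b1 : (0 < 1 <= b)%N by rewrite (ltnW b_gt1).
have up : u \in ucong n (p ^ 1) by rewrite expn1 p2 unit_ucong2 // -p2.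
have sF1' : ucong n (p ^ 1 * m) \subset stabU n t by rewrite expn1.
have [w [wi wm eq_uw]] := stabU_split b1 sF1' ui up.
have [f4 | nf4] := boolP (f \in ucong n (p ^ 2)).
  apply: (subsetP p2m); apply: ucong_lcm f4 _; first by rewrite coprimeXl.
  by apply: (subsetP (ucongS _ _)) Ff; rewrite dvdn_mull.
have nw4 : w \notin ucong n (p ^ 2).
  apply: contra nu4; rewrite !inE -(modn_dvdm (unat w) (dvdn_exp2l p b_gt1)) -eq_uw.
  by rewrite modn_dvdm // dvdn_exp2l.
have fw : (f * w^-1)%g \in K.
  apply: (subsetP p2m); apply: ucong_lcm; first by rewrite coprimeXl.
    by rewrite p2 in nf4 nw4 *; apply: ucong4_div.
  have fm : f \in ucongG n_gt1 dvdn_mn.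
    by apply: (subsetP (ucongS _ _)) Ff; rewrite dvdn_mull.
  have wm' : w \in ucongG n_gt1 dvdn_mn.
    by apply: (subsetP (ucongS _ _)) wm; rewrite dvdn_mull.
  by rewrite -[ucong _ _]/(gval (ucongG n_gt1 dvdn_mn)) groupM ?groupV.
rewrite -[stabU _ _]/(gval K) -(mulgKV w f) groupM //.
Qed.

End EvenPrime.

(** If not all units that are 1 mod p^(j-1) m fix chi_t, the bound for chi_t applies at level j.
    Otherwise let k be the least positive level whose units fix chi_t: the bound applies at level k,
    and inside [A] being 1 mod p^k implies being 1 mod p^j. For p = 2 and k = 1 the implication
    holds from 1 mod 4 on, at the cost of an index dividing 2; this suffices for even chi(1), and
    the determinant settles odd chi(1). *)
Lemma level_dvd_prime : level_dvd t -> level_dvd i.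
Proof.
move=> IHt A j /andP[j_gt0 le_jb] sA level_j; have [j1 | j_neq1] := eqVneq j 1%N.
  have sAp : A \subset ucong n (p ^ 1) by rewrite expn1 (subset_trans sA) ?subsetIr.
  have /eqP -> : #|A : ucong n (p ^ j)| == 1%N.
    by rewrite j1 (indexg_eq1 A (ucongG n_gt1 (dvdn_pn (leq_trans j_gt0 le_jb)))).
  exact: dvd1_irr1.
have j_gt1 : (1 < j)%N by rewrite ltn_neqAle eq_sym j_neq1.
have nsFi : ~~ (ucong n (p ^ j.-1 * m) \subset stabU n i).
  by case: level_j => // j1; rewrite j1 eqxx in j_neq1.
have Dchi1 : 'chi_i 1%g = 'chi_t 1%g by rewrite -Res_prime_homogeneous cfRes1.
have sAi : A \subset stabU n i by rewrite (subset_trans sA) ?subsetIl.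
have sAt : A \subset stabU n t :&: ucong n p.
  apply: subset_trans sA _; apply: setSI.
  exact: stabU_homogeneous (qprim nsNG) tR.
rewrite Dchi1; have [sFt | nsFt] := boolP (ucong n (p ^ j.-1 * m) \subset stabU n t); last first.
  by apply: IHt; rewrite ?j_gt0 //; right.
have ex_k : exists k, (0 < k)%N && (ucong n (p ^ k * m) \subset stabU n t).
  by exists j.-1; rewrite sFt andbT -ltnS prednK.
case: (ex_minnP ex_k) => k /andP[k_gt0 sFk] min_k.
have lt_kj : (k < j)%N by rewrite -(prednK j_gt0) ltnS min_k // sFt andbT -ltnS prednK.
have le_kb : (k <= b)%N := leq_trans (ltnW lt_kj) le_jb.
have eq_index l : (l <= j)%N -> A :&: ucong n (p ^ l) \subset ucong n (p ^ j) ->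
    #|A : ucong n (p ^ j)| = #|A : ucong n (p ^ l)|.
  move=> le_lj sAl; have le_lb := leq_trans le_lj le_jb.
  rewrite -(indexgI A (ucongG n_gt1 (dvdn_pn le_jb))) -(indexgI A (ucongG n_gt1 (dvdn_pn le_lb))) /=.
  congr #|_ : _|; apply/eqP; rewrite eqEsubset !subsetI !subsetIl sAl !andbT /=.
  by rewrite subIset // ucongS ?orbT // dvdn_exp2l.
have dvdk : (#|A : ucong n (p ^ k)|%:R %| 'chi_t 1%g)%C.
  apply: IHt; rewrite ?k_gt0 //; have [-> | k_neq1] := eqVneq k 1%N; [by left | right].
  apply/negP=> sFk1; have := min_k k.-1; rewrite sFk1 andbT -ltnS prednK //.
  by rewrite ltn_neqAle eq_sym k_neq1 k_gt0 => /(_ isT); rewrite -ltnS prednK // ltnn.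
have [/andP[/eqP p2 /eqP k1] | not21] := boolP ((p == 2) && (k == 1%N)); last first.
  rewrite (eq_index k) ?(ltnW lt_kj) //; apply/subsetP=> u /setIP[Au uk].
  apply: (stabU_gap _ not21 le_jb sFk nsFi) => //; first by rewrite k_gt0.
  exact: (subsetP sAi).
have b_gt1 := leq_trans j_gt1 le_jb.
rewrite k1 expn1 in sFk; have [even_t | odd_t] := boolP (2%:R %| 'chi_t 1%g)%C; last first.
  have /eqP -> : #|A : ucong n (p ^ j)| == 1%N.
    rewrite (indexg_eq1 A (ucongG n_gt1 (dvdn_pn le_jb))); apply/subsetP=> u Au.
    by apply: odd_stabU_gap => //; rewrite ?j_gt1 //; apply: (subsetP sAi).
  exact: dvd1_irr1.
rewrite (eq_index 2%N) //; last first.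
  apply/subsetP=> u /setIP[Au u2]; apply: (stabU_gap _ _ le_jb _ nsFi) u2 => //.
  - by rewrite andbF.
  - by apply: subset_trans sFk; rewrite ucongS // dvdn_mul ?dvdn_exp.
  exact: (subsetP sAi).
apply: dvdC_trans even_t; rewrite dvdC_natE p2.
have n4 : (4 %| n)%N by have := dvdn_pn b_gt1; rewrite p2.
exact: (index_ucong4 n_gt1 A n4).
Qed.

End PrimeIndex.

End Homogeneous.

End PrimeLevel.

(** * The induction on the order of the group *)

Section Main.

Variables (n : nat) (gT : finGroupType).
Hypotheses (n_gt1 : (1 < n)%N) (gTn : (#|[set: gT]| %| n)%N).
Variables (p b m : nat).
Hypotheses (pr_p : prime p) (Dn : n = (p ^ b * m)%N) (co_pm : coprime p m).
Implicit Types (G N T : {group gT}).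

(** The index in [A] divides |A : B| times the index in [B]; these divide |G : T| and chi_s(1),
    whose product is chi_i(1). The level hypothesis passes to [s] because the stabilizer of chi_s
    lies in that of chi_i. *)
Lemma level_dvd_Clifford G N (i : Iirr G) t (T := 'I_G['chi_t]%G) :
    N <| G -> t \in irr_constt ('Res[N] 'chi_i) ->
    (forall s : Iirr T, level_dvd n p b m s) -> level_dvd n p b m i.
Proof.
move=> nsNG tR IHT A k kb sA level_k.
have [s [Ds sSi sSs]] := Clifford_stabU n nsNG tR.
pose B := (A :&: stabU_group n_gt1 gTn t)%G.
have sAi : A \subset stabU n i by rewrite (subset_trans sA) ?subsetIl.
have sB : B \subset stabU n s :&: ucong n p.
  rewrite subsetI (subset_trans _ sSs) ?setSI //=.
  by rewrite subIset // (subset_trans sA) ?subsetIr.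
have dvB := IHT s B k kb sB.
have {dvB} dvB : (#|B : ucong n (p ^ k)|%:R %| 'chi_s 1%g)%C.
  apply: dvB; case: level_k => [|nsF]; [by left | right].
  by apply: contra nsF => /subset_trans->.
have sTG : T \subset G by apply: Inertia_sub.
rewrite -Ds cfInd1 //.
have dvA : (#|A : B| %| #|G : T|)%N := index_stabU_constt n_gt1 gTn nsNG tR sAi.
have [/andP[k_gt0 le_kb]] := (kb).
pose S := ucongG n_gt1 (dvdn_pn Dn le_kb).
apply: (@dvdC_trans _ (#|G : T|%:R * #|B : S|%:R)); last first.
  case/dvdCP: dvB => z Zz ->; rewrite mulrCA; apply: dvdC_mull => //.
rewrite -natrM dvdC_natE; apply: dvdn_trans (dvdn_mul dvA (dvdnn _)).
rewrite -[ucong _ _]/(gval S) -(indexgI A S) -(indexgI B S).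
rewrite Lagrange_index ?subsetIl //.
rewrite -(@Lagrange_index _ A (A :&: S)%G (B :&: S)%G) ?subsetIl ?setSI ?subsetIl //.
exact: dvdn_mulr.
Qed.

Theorem level_dvd_psolvable G (i : Iirr G) : subnormal_pser p G -> level_dvd n p b m i.
Proof.
have [r] := ubnP #|G|; elim: r G i => // r IHr G i /ltnSE-leGr serG.
have [/existsP[N /andP[nsNG /existsP[t /andP[tR neqT]]]] | ] :=
  boolP [exists N : {group gT}, (N <| G) && [exists t : Iirr N,
     (t \in irr_constt ('Res[N] 'chi_i)) && ('I_G['chi_t] != G)]].
  apply: level_dvd_Clifford nsNG tR _ => s; have sTG := Inertia_sub G 'chi_t.
  apply: IHr; last exact: subnormal_pserS serG.
  by apply: leq_trans leGr; rewrite proper_card // properEneq neqT.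
rewrite negb_exists => /forallP hom.
have qprim N : N <| G -> homogeneous_res i N.
  move=> nsNG j k jR kR; have [y Gy Dk] := constt_Res_conjg nsNG jR kR.
  have:= hom N; rewrite nsNG negb_exists => /forallP/(_ j).
  rewrite jR negbK => /eqP defT; apply: irr_inj; rewrite Dk inertiaJ //.
  by move: Gy; rewrite -{1}defT => /setIP[].
move=> A k kb sA level_k; have [k1 | k_neq1] := eqVneq k 1%N.
  have sAp : A \subset ucong n (p ^ 1) by rewrite expn1 (subset_trans sA) ?subsetIr.
  have /andP[_ le_kb] := kb.
  have /eqP -> : #|A : ucong n (p ^ k)| == 1%N.
    by rewrite (indexg_eq1 A (ucongG n_gt1 (dvdn_pn Dn le_kb))) /= k1.
  exact: dvd1_irr1.
have nsFi : ~~ (ucong n (p ^ k.-1 * m) \subset stabU n i).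
  by case: level_k => // k1; rewrite k1 eqxx in k_neq1.
have [G1 | ntG] := eqVneq (G : {set gT}) 1%g.
  case/negP: nsFi; apply/subsetP=> v _; apply/stabUP/cfun_inP=> x.
  have trivG : G \subset [1 gT]%g by rewrite G1.
  by move/(subsetP trivG)/set1P->; apply: cfAut_irr1.
have [N [serN nsNG ltNG p'_or_p]] := subnormal_pser_top pr_p serG ntG.
have [t tR] := constt_cfRes_irr N i.
have IHt : level_dvd n p b m t.
  by apply: IHr serN; apply: leq_trans leGr; rewrite proper_card.
have [p'GN | /eqP indexN] := orP p'_or_p; last first.
  have nserN := subnormal_normal_pser nsNG serN.
  exact: (level_dvd_prime n_gt1 gTn pr_p Dn co_pm qprim nsNG indexN nserN tR IHt).
have [q ->] := dvdn_constt_Res1_irr1 nsNG tR.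
apply: dvdC_mull; first exact: rpred_nat.
apply: IHt => //.
  by apply: subset_trans sA (setSI _ _); apply: stabU_homogeneous (qprim N nsNG) tR.
right; apply: contra nsFi; apply: (ucong_stabU_p' n_gt1 gTn pr_p Dn co_pm qprim nsNG p'GN tR).
have /andP[k_gt0 le_kb] := kb; rewrite (leq_trans (leq_pred _)) // andbT.
by rewrite -ltnS prednK // ltn_neqAle eq_sym k_neq1.
Qed.

End Main.

(** * The relative degree as an index *)

Lemma zeta_prim k : (0 < k)%N -> k.-primitive_root (zeta k).
Proof. by case: k => // k _ /=; case: C_prim_root_exists. Qed.

Lemma cyclotomic_field n : (1 < n)%N ->
  exists (Qn : splittingFieldType rat) (QnC : {rmorphism Qn -> algC}),
  [/\ galois 1 {:Qn},
      forall sg, sg \in 'Gal({:Qn} / 1)%g ->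
        exists v : {unit 'Z_n}, forall y, gal v (QnC y) = QnC (sg y),
      forall z, z ^+ n = 1 -> exists a, QnC a = z
    & forall (gT : finGroupType) (H : {group gT}) (phi : 'CF(H)) x,
        phi \is a character -> (#[x]%g %| n)%N -> exists a, QnC a = phi x].
Proof.
(* [group_num_field_exists] yields the cyclotomic field of the order of a group; the additive group
   of Z / n has order n. *)
move=> n_gt1; have cardZ : #|[set: 'Z_n]%G| = n by rewrite cardsT card_ord Zp_cast.
have [Qn galQn [QnC autQn [w [prim_w defQn] charQn]]] := group_num_field_exists [set: 'Z_n]%G.
rewrite cardZ in prim_w charQn.
have prim_wC : n.-primitive_root (QnC w) by rewrite fmorph_primitive_root.
exists Qn, QnC; split=> //.
- move=> sg Gsg; have prim_sw : n.-primitive_root (sg w) by rewrite fmorph_primitive_root.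
  have [i Di] := prim_rootP prim_w (prim_expr_order prim_sw).
  have co : coprime i n by rewrite Di prim_root_exp_coprime in prim_sw.
  have [v Dv] := exists_unit n_gt1 co; exists v => y.
  have [nu Dnu] := autQn sg.
  have galw : gal v (QnC w) = nu (QnC w).
    rewrite -Dnu Di rmorphXn /= (galE n_gt1 v (prim_expr_order prim_wC)).
    by apply/eqP;  rewrite (eq_prim_root_expr prim_wC) Dv.
  have [q Qq ->] := Fadjoin_polyP (etrans (congr1 (fun V : {vspace _} => y \in V) defQn) (memvf y)).
  rewrite Dnu; have evE (f : {rmorphism algC -> algC}) :
      f (QnC q.[w]) = (map_poly QnC q).[f (QnC w)].
    by rewrite -horner_map -horner_map -map_poly_comp /= map_Qnum_poly.
  by rewrite !evE galw.
- move=> z zn; have [i ->] := prim_rootP prim_wC zn.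
  by exists (w ^+ i); rewrite rmorphXn.
by move=> gT H phi x Nphi dvx; have [a Da] := charQn gT H phi Nphi x dvx; exists a.
Qed.

(** [rel_degree] computes in a number field of its own choice; this transports elements of a
    generated subfield to any other field whose generators have the same images. *)
Lemma map_adjoin_seq (L1 L2 : fieldExtType rat) (f1 : {rmorphism L1 -> algC})
    (f2 : {rmorphism L2 -> algC}) (s1 : seq L1) (s2 : seq L2) :
    map f1 s1 = map f2 s2 ->
  {in <<1 & s1>>%VS, forall x, exists2 y, y \in <<1 & s2>>%VS & f1 x = f2 y}.
Proof.
elim/last_ind: s1 s2 => [|s1 z1 IHs] s2.
  case: s2 => // _ x; rewrite !Fadjoin_nil => /vlineP[a ->].
  by exists (a%:A); [apply: rpredZ; apply: mem1v | rewrite !rmorphZ_num !rmorph1].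
case/lastP: s2 => [|s2 z2]; first by move/(congr1 size); rewrite !size_map size_rcons.
rewrite !map_rcons => /rcons_inj[Ds Dz] x; rewrite !adjoin_rcons.
case/Fadjoin_polyP=> q Eq ->.
have IHq k : exists y, (y \in <<1 & s2>>%VS) && (f1 q`_k == f2 y).
  by have [y Ey Dy] := IHs s2 Ds q`_k (polyOverP Eq k); exists y; rewrite Ey Dy eqxx.
pose g k := xchoose (IHq k).
have gP k : g k \in <<1 & s2>>%VS /\ f1 q`_k = f2 (g k).
  by have /andP[-> /eqP] := xchooseP (IHq k).
exists (\poly_(k < size q) g k).[z2].
  apply: (@mempx_Fadjoin _ _ <<1 & s2>>%AS).
  by apply/polyOver_poly => k _; case: (gP k).
rewrite -!horner_map -Dz; congr _.[_]; apply/polyP=> k; rewrite !coef_map coef_poly /=.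
case: ltnP => [_ | le_qk]; first by case: (gP k).
by rewrite nth_default ?rmorph0.
Qed.

Lemma fix_adjoin_seq (L : fieldExtType rat) (LC : {rmorphism L -> algC})
    (f : {rmorphism algC -> algC}) (s : seq L) :
    {in s, forall y, f (LC y) = LC y} -> {in <<1 & s>>%VS, forall y, f (LC y) = LC y}.
Proof.
elim/last_ind: s => [|s z IHs] fix_s x.
  by rewrite Fadjoin_nil => /vlineP[a ->]; rewrite rmorphZ_num rmorph1 mulr1 fmorph_rat.
rewrite adjoin_rcons => /(@Fadjoin_polyP _ _ <<1 & s>>%AS)[q Eq ->].
rewrite -!horner_map -map_poly_comp /= fix_s ?mem_rcons ?mem_head //.
congr _.[_]; apply/polyP=> k; rewrite !coef_map /= IHs ?(polyOverP Eq) // => y sy.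
by rewrite fix_s // mem_rcons inE sy orbT.
Qed.

Section Descent.

Variables (n : nat) (Qn : splittingFieldType rat) (QnC : {rmorphism Qn -> algC}).
Hypotheses (n_gt1 : (1 < n)%N) (galQn : galois 1 {:Qn}).
Hypothesis autQn : forall sg, sg \in 'Gal({:Qn} / 1)%g ->
  exists v : {unit 'Z_n}, forall y, gal v (QnC y) = QnC (sg y).

Lemma galois_descent (s : seq Qn) x :
    (forall v : {unit 'Z_n}, {in s, forall y, gal v (QnC y) = QnC y} ->
       gal v (QnC x) = QnC x) ->
  x \in <<1 & s>>%VS.
Proof.
move=> fix_x; pose E := <<1 & s>>%AS.
have s1E : (1 <= E)%VS by apply: sub1v.
have galE : galois E {:Qn} by apply: galoisS galQn; rewrite s1E subvf.
suff: x \in fixedField 'Gal({:Qn} / E)%g by rewrite (galois_fixedField galE).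
apply/fixedFieldP; rewrite ?memvf // => sg Gsg.
have [v Dv] := autQn (subsetP (galS _ s1E) _ Gsg).
apply: (fmorph_inj QnC); rewrite -Dv; apply: fix_x => y sy.
by rewrite Dv (fixed_gal _ Gsg) ?subvf // seqv_sub_adjoin.
Qed.

(** The conjugates of z over the field E generated by [s0] are the z^v with [v] in [A], and two of
    them agree when the units agree mod k. *)
Lemma rel_degree_index (s0 : seq Qn) (z0 : Qn) (A : {group {unit 'Z_n}}) k :
    (k %| n)%N -> k.-primitive_root (QnC z0) ->
    (forall v : {unit 'Z_n}, v \in A <-> {in s0, forall y, gal v (QnC y) = QnC y}) ->
  rel_degree (map QnC s0) [:: QnC z0] = #|A : ucong n k|%g.
Proof.
move=> kn prim_z AP; rewrite /rel_degree.
case: (num_field_exists _) => L [LC [s1 Ds gen]] /=.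
case/lastP: s1 Ds gen => [|s2 z1]; first by case: s0 {AP}.
rewrite map_rcons cats1 => /rcons_inj[Ds Dz] _.
have szs : size s2 = size (map QnC s0) by rewrite -Ds size_map.
rewrite -szs -cats1 take_size_cat // cats1 adjoin_rcons.
set E := <<1 & s2>>%AS.
rewrite -[<<1 & s2>>%VS]/(val E) -adjoin_degreeE; apply: succn_inj; rewrite -size_minPoly.
rewrite -[ucong n k]/(gval (ucongG n_gt1 kn)) -indexgI.
pose S := (A :&: ucongG n_gt1 kn)%G; rewrite -[_ :&: _]/(gval S).
pose r := [seq QnC z0 ^+ unat (repr C) | C in rcosets S A].
have zE (v : {unit 'Z_n}) : gal v (QnC z0) = QnC z0 ^+ unat v.
  rewrite (galE n_gt1) //; have [q Dq] := dvdnP kn.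
  by rewrite {1}Dq mulnC exprM (prim_expr_order prim_z) expr1n.
have zM (v w : {unit 'Z_n}) : QnC z0 ^+ unat (v * w)%g = (QnC z0 ^+ unat v) ^+ unat w.
  rewrite -exprM; apply/eqP; rewrite (eq_prim_root_expr prim_z); apply/eqP.
  exact: unatM_mod.
have z_eq : {in A &, forall v w : {unit 'Z_n},
    (QnC z0 ^+ unat v == QnC z0 ^+ unat w) = (S :* v == S :* w)}.
  move=> v w Av Aw; rewrite (eq_prim_root_expr prim_z).
  have mem_S : ((v * w^-1)%g \in S) = ((v * w^-1)%g \in ucong n k).
    by rewrite inE /= groupM ?groupV.
  apply/eqP/eqP=> [/(eqmod_ucong n_gt1 kn) vw | /rcoset_eqP].
    by apply/rcoset_eqP; rewrite mem_rcoset mem_S.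
  by rewrite mem_rcoset mem_S => /(eqmod_ucong n_gt1 kn).
have A_repr (v : {unit 'Z_n}) : v \in A -> repr (S :* v) \in A.
  move=> Av; have /rcosetP[w /setIP[Aw _] ->] := mem_repr_rcoset S v.
  exact: groupM.
have mem_r (v : {unit 'Z_n}) : v \in A -> QnC z0 ^+ unat v \in r.
  move=> Av; apply/imageP; exists (S :* v); first by apply/rcosetsP; exists v.
  by apply/eqP; rewrite z_eq ?A_repr // rcoset_repr.
have repr_r y : y \in r -> exists2 v, v \in A & y = QnC z0 ^+ unat v.
  by case/imageP=> _ /rcosetsP[v Av ->] ->; exists (repr (S :* v)); rewrite ?A_repr.
have Ur : uniq r.
  rewrite map_inj_in_uniq ?enum_uniq // => C D; rewrite !mem_enum.
  move=> /rcosetsP[v Av ->] /rcosetsP[w Aw ->] /eqP.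
  by rewrite z_eq ?A_repr // !rcoset_repr => /eqP.
have size_r : size r = #|A : S|%g by rewrite size_image.
have fix_E (v : {unit 'Z_n}) : v \in A -> {in E, forall y, gal v (LC y) = LC y}.
  move/AP=> fix_v; apply: fix_adjoin_seq => y sy.
  have: LC y \in map QnC s0 by rewrite -Ds map_f.
  by case/mapP=> y0 sy0 ->; apply: fix_v.
apply/eqP; rewrite eqn_leq; apply/andP; split.
  (* Upper bound: the product over these conjugates is fixed by [A], so descent in [Qn] puts its
     coefficients in E, and [liftP] moves them to [L]. *)
  pose P0 := \prod_(C in rcosets S A) ('X - (z0 ^+ unat (repr C))%:P).
  have DP0 : map_poly QnC P0 = \prod_(y <- r) ('X - y%:P).
    rewrite rmorph_prod big_image /=; apply: eq_bigr => C _.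
    by rewrite rmorphB /= map_polyX map_polyC /= rmorphXn.
  have P0_s0 j : P0`_j \in <<1 & s0>>%VS.
    apply: galois_descent => v fix_v; have Av : v \in A by apply/AP.
    have fixP : map_poly (gal v) (map_poly QnC P0) = map_poly QnC P0.
      rewrite DP0 rmorph_prod /=; under eq_bigr do rewrite rmorphB /= map_polyX map_polyC /=.
      rewrite -(big_map (gal v) xpredT (fun y => 'X - y%:P)); apply: perm_big.
      have Ugr : uniq (map (gal v) r) by rewrite map_inj_uniq //; apply: fmorph_inj.
      have sub_r : {subset map (gal v) r <= r}.
        move=> _ /mapP[y /repr_r[w Aw ->] ->].
        by rewrite rmorphXn /= zE -zM mem_r ?groupM.
      have le_r : (size r <= size (map (gal v) r))%N by rewrite size_map.
      by apply: uniq_perm => //; have [] := uniq_min_size Ugr sub_r le_r.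
    by have := congr1 (fun q : {poly algC} => q`_j) fixP; rewrite !coef_map.
  have liftP j : exists y, (y \in E) && (QnC P0`_j == LC y).
    have [y Ey Dy] := map_adjoin_seq (esym Ds) (P0_s0 j).
    by exists y; rewrite Ey Dy eqxx.
  pose P1 := \poly_(j < size P0) xchoose (liftP j).
  have DP1 : map_poly LC P1 = map_poly QnC P0.
    apply/polyP=> j; rewrite !coef_map coef_poly /=; case: ltnP => [_|le_Pj].
      by have /andP[_ /eqP] := xchooseP (liftP j).
    by rewrite [in RHS]nth_default ?rmorph0.
  have EP1 : P1 \is a polyOver E.
    by apply/polyOver_poly => j _; have /andP[] := xchooseP (liftP j).
  have rootP1 : root P1 z1.
    rewrite -(fmorph_root LC) DP1 DP0 root_prod_XsubC Dz.
    by have := mem_r 1%g (group1 A); rewrite unat1 expr1.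
  have szP1 : size P1 = #|A : S|%g.+1.
    by rewrite -(size_map_poly LC) DP1 DP0 size_prod_XsubC size_r.
  rewrite -szP1 dvdp_leq ?minPoly_dvdp //.
  by rewrite -size_poly_gt0 szP1.
(* Lower bound: [A] fixes E, so each z^v is a root of the minimal polynomial. *)
rewrite -size_r -(size_map_poly LC) max_poly_roots ?map_poly_eq0 ?monic_neq0 ?monic_minPoly //.
apply/allP=> _ /repr_r[v Av ->].
have Dq : map_poly (gal v) (map_poly LC (minPoly E z1)) = map_poly LC (minPoly E z1).
  apply/polyP=> j; rewrite !coef_map /= fix_E //.
  exact: polyOverP (minPolyOver E z1) j.
rewrite -Dq -zE fmorph_root -Dz fmorph_root; exact: root_minPoly.
Qed.

End Descent.

Section Conductor.

Variable n : nat.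
Hypothesis n_gt1 : (1 < n)%N.
Implicit Types v w : {unit 'Z_n}.

Lemma zeta_expn d : (0 < d)%N -> (d %| n)%N -> zeta d ^+ n = 1.
Proof.
move=> d_gt0 /dvdnP[q ->].
by rewrite mulnC exprM (prim_expr_order (zeta_prim d_gt0)) expr1n.
Qed.

Lemma gal_zetaE v d : (0 < d)%N -> (d %| n)%N ->
  (gal v (zeta d) == zeta d) = (v \in ucong n d).
Proof.
move=> d_gt0 dn; rewrite (galE n_gt1) ?zeta_expn // -[X in _ == X]expr1.
by rewrite (eq_prim_root_expr (zeta_prim d_gt0)) inE.
Qed.

Lemma gal_inQn v d x : (0 < d)%N -> (d %| n)%N -> v \in ucong n d -> inQn d x ->
  gal v x = x.
Proof.
move=> d_gt0 dn; rewrite -gal_zetaE // => /eqP fix_z [q ->].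
rewrite -horner_map fix_z -map_poly_comp; congr _.[_].
by apply: eq_map_poly => a /=; rewrite fmorph_rat.
Qed.

Variables (gT : finGroupType) (G : {group gT}) (i : Iirr G).
Hypothesis gTn : (#|[set: gT]| %| n)%N.

Lemma valsInQn_ucong d : (0 < d)%N -> (d %| n)%N ->
  valsInQn 'chi_i d <-> ucong n d \subset stabU n i.
Proof.
move=> d_gt0 dn; split=> [vals | /subsetP sd g Gg].
  apply/subsetP=> v vd; apply/stabUP/cfun_inP=> g Gg; rewrite cfunE.
  exact: gal_inQn vd (vals g Gg).
have [Qn [QnC [galQn autQn rootQn charQn]]] := cyclotomic_field n_gt1.
have [x0 Dx0] : exists a, QnC a = 'chi_i g.
  by apply: charQn; rewrite ?irr_char // order_dvdn (expgn1 gTn).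
have [z0 Dz0] := rootQn _ (zeta_expn d_gt0 dn).
have: x0 \in <<1 & [:: z0]>>%VS.
  apply: (galois_descent galQn autQn) => v fix_v; rewrite Dx0.
  have /stabUP : v \in stabU n i.
    by apply: sd; rewrite -gal_zetaE // -Dz0 fix_v ?mem_head.
  by move/(congr1 (fun f : 'CF(G) => f g)); rewrite cfunE.
rewrite adjoin_seq1 => /Fadjoin_polyP[q /polyOver1P[r ->] Dx].
exists r; rewrite -Dx0 Dx -horner_map Dz0 -map_poly_comp; congr _.[_].
by apply: eq_map_poly => a /=; rewrite rmorphZ_num rmorph1 mulr1.
Qed.

End Conductor.

Lemma map_preimage_seq (A B : eqType) (f : A -> B) (s : seq B) :
  (forall y, y \in s -> exists x, f x = y) -> exists s0, map f s0 = s.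
Proof.
elim: s => [|y s IHs] pre_s; first by exists [::].
have [x Dx] := pre_s y (mem_head _ _).
have [|s0 Ds] := IHs; first by move=> z sz; apply: pre_s; rewrite inE sz orbT.
by exists (x :: s0); rewrite /= Dx Ds.
Qed.

Theorem theorem3p2 (gT : finGroupType) (G : {group gT}) (p : nat) (i : Iirr G)
  (c : nat) :
  prime p -> psolvable p G -> is_conductor 'chi_i c -> (1 <= logn p c)%N ->
  ((rel_degree (rcons (cfvals 'chi_i) (zeta p)) [:: zeta (p ^ logn p c)])%:R
     %| 'chi_i 1%g)%C.
Proof.
move=> pr_p solG [c_gt0 [vals_c min_c]]; set a := logn p c => a_gt0.
(* A multiple of all element orders and of the conductor, so Q_n contains the character values and
   both roots of unity. *)
pose n := (#|[set: gT]| * c)%N.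
have cn : (c %| n)%N by rewrite dvdn_mull.
have gTn : (#|[set: gT]| %| n)%N by rewrite dvdn_mulr.
have n_gt0 : (0 < n)%N by rewrite muln_gt0 c_gt0 andbT (cardG_gt0 [set: gT]%G).
have pc : (p %| c)%N by rewrite -[p]expn1 pfactor_dvdn.
have pn : (p %| n)%N := dvdn_trans pc cn.
have n_gt1 : (1 < n)%N := leq_trans (prime_gt1 pr_p) (dvdn_leq n_gt0 pn).
pose b := logn p n; pose m := (n`_p^')%N.
have Dn : n = (p ^ b * m)%N by rewrite -p_part partnC.
have co_pm : coprime p m by rewrite prime_coprime // -p'natE // part_pnat.
have le_ab : (a <= b)%N by apply: dvdn_leq_log.
have an : (p ^ a %| n)%N := dvdn_pn Dn le_ab.
(* The Galois group of Q_n over Q_p(chi). *)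
pose A := (stabU_group n_gt1 gTn i :&: ucongG n_gt1 pn)%G.
have level_a : a = 1%N \/ ~~ (ucong n (p ^ a.-1 * m) \subset stabU n i).
  have [a1 | a_neq1] := eqVneq a 1%N; [by left | right].
  (* Otherwise chi has values in Q_d with d = c / p. For [v] that is 1 mod d take [w] equal to [v]
     mod p^b and to 1 mod m: [w] is 1 mod p^(a-1) m and v / w is 1 mod c, so both fix chi. *)
  apply/negP=> sFi; pose d := (c %/ p)%N.
  have Dc : (c = p * d)%N by rewrite mulnC divnK.
  have d_gt0 : (0 < d)%N by move: c_gt0; rewrite Dc muln_gt0 => /andP[].
  have dn : (d %| n)%N by apply: dvdn_trans cn; rewrite Dc dvdn_mull.
  suff /(min_c d d_gt0) : valsInQn 'chi_i d.
    by rewrite leqNgt Dc ltn_Pmull ?prime_gt1.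
  apply/(valsInQn_ucong n_gt1 i gTn d_gt0 dn); apply/subsetP=> v vd.
  have sci : ucong n c \subset stabU n i by apply/(valsInQn_ucong n_gt1 i gTn c_gt0 cn).
  have [w [wm eq_vw vwb]] := ucong_factor n_gt1 v Dn (coprime_pXm b co_pm).
  have mn : (m %| n)%N := dvdn_mn Dn.
  pose c' := (c`_p^')%N.
  have Dcc : c = (p ^ a * c')%N by rewrite -p_part partnC.
  have co_ac' : coprime (p ^ a) c'.
    by rewrite coprimeXl // prime_coprime // -p'natE // part_pnat.
  have c'm : (c' %| m)%N by apply: partn_dvd.
  have c'n : (c' %| n)%N := dvdn_trans c'm mn.
  have c'd : (c' %| d)%N.
    by rewrite -(@Gauss_dvdr _ p) -?Dc ?dvdn_part // coprime_sym prime_coprime // -p'natE // part_pnat.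
  have pad : (p ^ a.-1 %| d)%N.
    by rewrite -(dvdn_pmul2l (prime_gt0 pr_p)) -expnS prednK // -Dc pfactor_dvdn.
  have w_i : w \in stabU_group n_gt1 gTn i.
    apply: (subsetP sFi); apply: ucong_lcm wm; first by rewrite coprimeXl.
    have: v \in ucong n (p ^ a.-1) := subsetP (ucongS _ pad) v vd.
    have le_b : (p ^ a.-1 %| p ^ b)%N by rewrite dvdn_exp2l // (leq_trans (leq_pred _)).
    by rewrite !inE -(modn_dvdm (unat w) le_b) -eq_vw modn_dvdm.
  have vw_i : (v * w^-1)%g \in stabU_group n_gt1 gTn i.
    apply: (subsetP sci); rewrite Dcc; apply: ucong_lcm => //.
      by apply: (subsetP (ucongS _ _)) vwb; rewrite dvdn_exp2l.
    have vc' : v \in ucongG n_gt1 c'n := subsetP (ucongS _ c'd) v vd.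
    have wc' : w \in ucongG n_gt1 c'n := subsetP (ucongS _ c'm) w wm.
    by rewrite -[ucong _ _]/(gval (ucongG n_gt1 c'n)) groupM ?groupV.
  by rewrite -[stabU _ _]/(gval (stabU_group n_gt1 gTn i)) -(mulgKV w v) groupM.
have dvd_index : (#|A : ucong n (p ^ a)|%:R %| 'chi_i 1%g)%C.
  apply: (level_dvd_psolvable n_gt1 gTn pr_p Dn co_pm) level_a => //.
    exact: psolvable_subnormal_pser.
  by rewrite a_gt0.
have p_gt0 := prime_gt0 pr_p; have pa_gt0 : (0 < p ^ a)%N by rewrite expn_gt0 p_gt0.
have [Qn [QnC [galQn autQn rootQn charQn]]] := cyclotomic_field n_gt1.
have [z0 Dz0] := rootQn _ (zeta_expn pa_gt0 an).
have [s0 Ds0] : exists s0, map QnC s0 = rcons (cfvals 'chi_i) (zeta p).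
  apply: map_preimage_seq => y; rewrite mem_rcons inE => /predU1P[-> | /imageP[g Gg ->]].
    exact: rootQn (zeta_expn p_gt0 pn).
  by apply: charQn; rewrite ?irr_char // order_dvdn (expgn1 gTn).
rewrite -Ds0 -Dz0 (rel_degree_index n_gt1 galQn autQn (A := A) an) //.
  by rewrite Dz0 zeta_prim.
move=> v; split=> [/setIP[/stabUP vi vp] y sy | fix_v].
  have: QnC y \in rcons (cfvals 'chi_i) (zeta p) by rewrite -Ds0 map_f.
  rewrite mem_rcons inE => /predU1P[-> | /imageP[g Gg ->]].
    by apply/eqP; rewrite (gal_zetaE n_gt1).
  by rewrite -[in RHS]vi cfunE.
have fix_s y : y \in rcons (cfvals 'chi_i) (zeta p) -> gal v y = y.
  by rewrite -Ds0 => /mapP[y0 sy0 ->]; apply: fix_v.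
rewrite inE; apply/andP; split.
  apply/stabUP/cfun_inP=> g Gg; rewrite cfunE fix_s // mem_rcons inE.
  by apply/orP; right; apply/imageP; exists g.
by rewrite /= -(gal_zetaE n_gt1) // fix_s // mem_rcons mem_head.
Qed.
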